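(* Let $\lambda=(\lambda_1,\ldots,\lambda_{l(\lambda)})$ be an integer partition with $m_1(\lambda)=0$, i.e. $\lambda_{l(\lambda)}\ge2$. Then the coefficient $b_\lambda(\Gamma)$ of the Chern number $C_\lambda[\cdot]$ in the $\Gamma$-genus is given by $$b_\lambda(\Gamma)=\frac{\zeta_S(\lambda_1,\ldots,\lambda_{l(\lambda)})}{\prod_i m_i(\lambda)!},$$ which is always positive. In particular, these determine all the coefficients for Calabi-Yau manifolds (i.e. for a Calabi-Yau manifold $M$ of complex dimension $n$, only Chern numbers $C_\lambda[M]$ with $|\lambda|=n$ and $m_1(\lambda)=0$ are involved in the value of the $\Gamma$-genus on $M$, and their coefficients are given by $b_\lambda(\Gamma)=\zeta_S(\lambda_1,\ldots,\lambda_{l(\lambda)})/\prod_i m_i(\lambda)!$).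
   Context: An integer partition $\lambda=(\lambda_1,\ldots,\lambda_{l})$ is a finite sequence of positive integers $\lambda_1\ge\cdots\ge\lambda_l\ge1$; $l(\lambda)=l$ is its length, $|\lambda|=\sum_i\lambda_i$ its weight, and $m_i(\lambda)$ is the number of parts equal to $i$; $0!:=1$. Complex genera: a complex genus $\varphi$ corresponds to a formal power series $Q(x)=1+\sum_{i\ge1}a_ix^i$. The coefficients $b_\lambda(\varphi)$, indexed by integer partitions $\lambda$, are defined by the expansion $$\prod_{i=1}^\infty Q(x_i)=1+\sum_{|\lambda|\ge1}b_\lambda(\varphi)\,e_\lambda(\mathbf{x}),\qquad e_\lambda=\prod_{i=1}^{l(\lambda)}e_{\lambda_i},$$ where $e_k=e_k(x_1,x_2,\ldots)$ is the $k$-th elementary symmetric function in countably many commuting variables. For a compact almost-complex manifold $M$ of real dimension $2n$ with Chern classes $c_i$, $\varphi(M)=\sum_{|\lambda|=n}b_\lambda(\varphi)C_\lambda[M]$, where $C_\lambda[M]=\int_M c_{\lambda_1}\cdots c_{\lambda_{l(\lambda)}}$ is the Chern number. The $\Gamma$-genus is the complex genus (with real coefficients) whose power series is $$Q(x)=\frac{1}{\Gamma(1+x)}=\exp(\gamma x)\prod_{i=1}^\infty\left[\left(1+\frac{x}{i}\right)\exp\left(-\frac{x}{i}\right)\right],$$ expanded at $x=0$, where $\gamma=\lim_{n\to\infty}\left[\sum_{i=1}^n\frac1i-\ln n\right]$ is the Euler constant. For real $t_1,\ldots,t_r>1$, $$\zeta(t_1,\ldots,t_r)=\sum_{n_1>n_2>\cdots>n_r\ge1}\frac{1}{n_1^{t_1}\cdots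 n_r^{t_r}},\qquad \zeta_S(t_1,\ldots,t_r)=\sum_{\sigma\in S_r}\zeta(t_{\sigma(1)},\ldots,t_{\sigma(r)}),$$ where $S_r$ is the permutation group of $\{1,\ldots,r\}$. A Calabi-Yau manifold is meant in the weak sense that its first Chern class is a torsion element. *)

(* Defs.v *)
From HB Require Import structures.
From mathcomp Require Import all_boot all_order all_algebra all_fingroup.
From mathcomp Require mpoly.
From mathcomp Require Import all_classical all_reals all_analysis.
Set Implicit Arguments.
Unset Strict Implicit.
Unset Printing Implicit Defensive.
Import Order.TTheory GRing.Theory Num.Theory.
Import numFieldNormedType.Exports.
(* The notations of mpoly clash with those of MathComp-Analysis. *)
Import -(notations) mpoly.
Local Open Scope classical_set_scope.
Local Open Scope ring_scope.

(* The empty partition is allowed; it indexes the constant term of the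
   expansion of a genus. *)
Definition is_intpart (s : seq nat) : bool := sorted geq s && (0%N \notin s).

Record intpart := IntPart { parts :> seq nat; _ : is_intpart parts }.

HB.instance Definition _ := [isSub for parts].
HB.instance Definition _ := [Choice of intpart by <:].

Definition weight (la : intpart) : nat := sumn la.

Definition multiplicity (i : nat) (la : intpart) : nat := count_mem i la.

(* The parts of [la] lie between 1 and [weight la], so the remaining factors
   of the product over all i >= 1 are 0! = 1. *)
Definition mult_fact (la : intpart) : nat :=
  (\prod_(1 <= i < (weight la).+1) (multiplicity i la)`!)%N.

Section Genus.
Variable R : comNzRingType.

Definition elem_sym (N : nat) (la : intpart) : mpoly N R :=
  \prod_(k <- parts la) mesym N R k.

(* The product of Q(x_i) over i < N, where Q = \sum_k a_k x^k is cut after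
   degree d; this does not alter the components of degree at most d. *)
Definition trunc_prod (a : nat -> R) (N d : nat) : mpoly N R :=
  \prod_(i < N) \sum_(k < d.+1) a k *: mpolyX R (mnm1 i) ^+ k.

(* \prod_(i >= 1) Q(x_i) = \sum_la b_la e_la(x), an identity of formal power
   series in countably many variables: for all N and d, the homogeneous
   components of degree d of both sides agree once all variables but the first
   N are set to 0. *)
Definition genus_expansion (a : nat -> R) (b : intpart -> R) : Prop :=
  forall N d : nat,
    pihomog (@mdeg N) d (trunc_prod a N d)
    = \sum_(la \in [set la : intpart | weight la = d]) b la *: elem_sym N la.

(* [b_la] is the unique solution of [genus_expansion a], and 0 if there is
   none. *)
Definition genus_coeff (a : nat -> R) : intpart -> R :=
  xget (fun=> 0) [set b : intpart -> R | genus_expansion a b].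

End Genus.

(* The cohomological data which determine the Chern numbers of a compact
   almost-complex manifold of real dimension 2n: the commutative graded ring
   \bigoplus_i H^{2i}(M; Z), with [component i] the projection onto H^{2i}, the
   Chern classes, and the evaluation on the fundamental class. *)
Record chern_data (n : nat) := ChernData {
  cohomology : comPzRingType;
  component : nat -> {additive cohomology -> cohomology};
  _ : forall i j x,
    component i (component j x) = if i == j then component i x else 0;
  _ : forall x, x = \sum_(i < n.+1) component i x;
  _ : component 0 1 = 1;
  _ : forall i j x y,
    component (i + j) (component i x * component j y)
    = component i x * component j y;
  chern_class : nat -> cohomology;
  _ : chern_class 0 = 1;
  _ : forall i, component i (chern_class i) = chern_class i;
  fund_eval : {additive cohomology -> int};
  _ : forall i x, i != n -> fund_eval (component i x) = 0
}.

Definition chern_number n (M : chern_data n) (la : intpart) : int :=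
  fund_eval M (\prod_(k <- parts la) chern_class M k).

Definition calabi_yau n (M : chern_data n) : Prop :=
  exists2 k : nat, (0 < k)%N & chern_class M 1 *+ k = 0.

Section Gamma.
Variable R : realType.

Definition genus (a : nat -> R) n (M : chern_data n) : R :=
  \sum_(la \in [set la : intpart | weight la = n])
    genus_coeff a la * (chern_number M la)%:~R.

Definition euler_gamma : R :=
  lim ((\sum_(1 <= i < n.+1) i%:R^-1 - ln n%:R : R) @[n --> \oo]).

(* 1 / Gamma(1 + x), by the Weierstrass product *)
Definition inv_Gamma1 (x : R) : R :=
  expR (euler_gamma * x) *
  lim ((\prod_(1 <= i < n.+1) ((1 + x / i%:R) * expR (- (x / i%:R))))
       @[n --> \oo]).

Definition taylor_coeff (f : R -> R) (k : nat) : R := derive1n k f 0 / k`!%:R.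

Definition Gamma_series : nat -> R := taylor_coeff inv_Gamma1.

(* Multiple zeta values, as sums of nonnegative terms over the decreasing
   tuples n_1 > ... > n_r >= 1; [fine] takes the value in R of a finite sum. *)
Definition mzeta r (t : 'I_r -> R) : R :=
  fine (\esum_(n in [set n : {ffun 'I_r -> nat} |
            (forall i j : 'I_r, (i < j)%N -> (n j < n i)%N)
            /\ (forall i, (1 <= n i)%N)])
          ((\prod_(i < r) ((n i)%:R `^ t i))^-1)%:E).

Definition mzetaS r (t : 'I_r -> R) : R :=
  \sum_(s : 'S_r) mzeta (fun i => t (s i)).

Definition mzetaS_part (la : intpart) : R :=
  mzetaS (fun i : 'I_(size la) => (nth 0%N la i)%:R).

End Gamma.

(* Main.v *)
From HB Require Import structures.
Require Import Defs.
From mathcomp Require Import all_boot all_order all_algebra all_fingroup.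
From mathcomp Require mpoly.
From mathcomp Require Import all_classical all_reals all_analysis.
From mathcomp Require Import ring lra zify.
Set Implicit Arguments.
Unset Strict Implicit.
Unset Printing Implicit Defensive.
Import Order.TTheory GRing.Theory Num.Theory.
Import numFieldNormedType.Exports.
Import -(notations) mpoly.
Local Open Scope classical_set_scope.
Local Open Scope ring_scope.

(** Why the theorem holds.  If Q(x) is a finite product of factors 1 + y x with
    y in a list ys (an alphabet), the dual Cauchy identity
      prod_i prod_(y in ys) (1 + y x_i) = sum_la m_la(ys) e_la(x)
    says that the coefficients of the genus are the monomial symmetric functions
    m_la(ys) ([genus_expansion_esym]).  The series of the Gamma-genus would be of
    this kind for the alphabet 1, 1/2, 1/3, ..., but for the factor exp(c x),
    with c = gamma - (1 + 1/2 + ... + 1/n) unbounded, that makes the product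
    converge.  This factor is close to (1 + c x / L)^L for large L, which amounts
    to adding L letters equal to c / L.  The resulting finite alphabet
    [approx_alphabet n] has first power sum exactly gamma, and its k-th power sum
    tends to zeta(k) for k > 1.

    Three limits are then taken along these alphabets.
    - By Newton's identities the e_k converge, and |e_k| <= D^k for a D
      independent of n; Tannery's theorem identifies the limits of the e_k with
      the Taylor coefficients of 1 / Gamma(1 + x) ([taylor_coeff_weierstrass]).
    - The coefficients of a genus depend continuously on its series
      ([genus_coeff_limit]): the polynomials e_la of a given degree are linearly
      independent, so each b_la is a fixed linear combination of coefficients
      of the product of the Q(x_i).  Hence b_la(Gamma) is the limit of the
      m_la of the alphabets.
    - The product of m_la and all the m_i(la)! is the sum over injective n of the
      products of the y_(n_i)^(la_i) ([inj_sum]).  When every part is at least 2,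
      the L letters c / L change this sum by at most a constant times
      L (c / L)^2, which tends to 0 ([inj_sum_approx_alphabet_cvg]).  Over 1,
      1/2, ..., 1/n alone, sorting the indices turns the sum into a sum over
      S_r of truncated multiple zeta values ([sum_perm_trunc_mzeta]), whose
      limit is zeta_S(la).

    Positivity holds because the truncated sums are nondecreasing in n and
    become positive.  On a Calabi-Yau manifold a positive multiple of c_1 is 0, so a
    Chern number with a factor c_1 is a torsion integer, hence 0. *)

(** * Sums over injective choices of letters *)

Lemma perm_rem (T : eqType) (k : T) (s t : seq T) :
  perm_eq s t -> perm_eq (rem k s) (rem k t).
Proof.
move=> st; have [ks|ks] := boolP (k \in s); last first.
  by rewrite !rem_id // -(perm_mem st).
rewrite -(perm_cons k); have kt : k \in t by rewrite -(perm_mem st).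
by rewrite -(permPl (perm_to_rem ks)) (permPl st) perm_to_rem.
Qed.

Section InjSum.
Variable R : comNzRingType.
Implicit Types (ys : seq R) (t : seq nat) (y : R).

(** The sum over all injective n of the products of the y_(n_i)^(t_i): the
    letter y is either left out or assigned to exactly one entry of t.  Deleting
    entries with [rem] makes the result depend on t only up to permutation. *)
Fixpoint inj_sum ys t : R :=
  if ys is y :: ys' then
    inj_sum ys' t + \sum_(k <- t) y ^+ k * inj_sum ys' (rem k t)
  else (t == [::])%:R.

Lemma inj_sum_perm ys t t' : perm_eq t t' -> inj_sum ys t = inj_sum ys t'.
Proof.
elim: ys t t' => [|y ys IH] t t' tt'.
  by congr (nat_of_bool _)%:R; rewrite -!size_eq0 (perm_size tt').
rewrite /= (IH _ _ tt') (perm_big _ tt') /=; congr (_ + _).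
by apply: eq_bigr => k _; rewrite (IH _ _ (perm_rem k tt')).
Qed.

Definition factor_poly y : {poly R} := 1 + y *: 'X.

Definition esym_seq ys (k : nat) : R := (\prod_(y <- ys) factor_poly y)`_k.

End InjSum.

(** * The product of the Q(x_i) for Q a product of linear factors *)

Section GenFun.
Variables (R : comNzRingType) (N : nat).
Implicit Types (ys : seq R) (y : R) (i : 'I_N).

Local Notation Xv i := (mpolyX R (mnm1 i) : mpoly N R).

Definition gen_prod ys : mpoly N R :=
  \prod_(i < N) \prod_(y <- ys) (1 + y *: Xv i).

Lemma mcoeff_prod_powers (K : nat) (a : nat -> R) (m : multinom N) :
  (forall i, m i < K)%N ->
  mcoeff m (\prod_(i < N) \sum_(k < K) a k *: Xv i ^+ k) = \prod_(i < N) a (m i).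
Proof.
move=> mK; rewrite bigA_distr_bigA /= raddf_sum /=.
pose f0 : {ffun 'I_N -> 'I_K} := [ffun i => Ordinal (mK i)].
rewrite (bigD1 f0) //= [X in _ + X]big1 ?addr0; last first.
  move=> f neq; rewrite scaler_prod mcoeffZ.
  rewrite (_ : \prod_(i < N) Xv i ^+ f i = mpolyX R (Multinom [tuple (f i : nat) | i < N])).
    rewrite mcoeffX; case: eqP => [e|]; last by rewrite mulr0.
    case/eqP: neq; apply/ffunP => i; rewrite ffunE; apply: val_inj => /=.
    by rewrite -e mnmE.
  rewrite mpolyXE_id; apply: eq_bigr => i _; by rewrite mnmE.
rewrite scaler_prod mcoeffZ.
rewrite (_ : \prod_(i < N) Xv i ^+ f0 i = mpolyX R m).
  rewrite mcoeffX eqxx mulr1; apply: eq_bigr => i _; by rewrite ffunE.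
by rewrite mpolyXE_id; apply: eq_bigr => i _; rewrite ffunE.
Qed.

(** Evaluation at x is an algebra morphism, so the coefficients of the product
    of the 1 + y 'X, a polynomial of degree at most the size of ys, give the
    expansion. *)
Lemma prod_factor_expand ys (x : mpoly N R) K : (size ys < K)%N ->
  \prod_(y <- ys) (1 + y *: x) = \sum_(k < K) esym_seq ys k *: x ^+ k.
Proof.
move=> ysK.
have -> : \prod_(y <- ys) (1 + y *: x)
         = horner_alg x (\prod_(y <- ys) factor_poly y).
  rewrite rmorph_prod; apply: eq_bigr => y _.
  by rewrite /factor_poly rmorphD rmorph1 -mul_polyC rmorphM /= horner_algC horner_algX mulr_algl.
rewrite /esym_seq; set p := \prod_(y <- ys) _.
have sp : (size p <= K)%N.
  rewrite (leq_trans _ ysK) //.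
  rewrite /p big_tnth (leq_trans (size_prod_leq _ _)) //.
  rewrite leq_subLR card_ord.
  have -> : ((size ys + (size ys).+1) = (\sum_(i < size ys) 2).+1)%N.
    by rewrite sum_nat_const card_ord; lia.
  rewrite ltnS leq_sum // => i _; rewrite /factor_poly.
  rewrite (leq_trans (size_polyD _ _)) // geq_max size_poly1 /=.
  by rewrite (leq_trans (size_scale_leq _ _)) ?size_polyX.
rewrite [p in LHS](_ : p = \sum_(k < K) p`_k *: 'X^k).
  rewrite rmorph_sum /=; apply: eq_bigr => k _.
  by rewrite -mul_polyC rmorphM rmorphXn /= horner_algC horner_algX mulr_algl.
rewrite -[LHS](take_poly_id sp) /take_poly poly_def; by apply: eq_bigr.
Qed.

Lemma mcoeff_pihomog d (p : mpoly N R) m :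
  mcoeff m (pihomog (@mdeg N) d p) = if mdeg m == d then mcoeff m p else 0.
Proof.
rewrite pihomogE raddf_sum /=; have [md|nd] := eqVneq (mdeg m) d; last first.
  rewrite big1 // => m' /eqP md'; rewrite mcoeffZ mcoeffX.
  by case: eqP => [e|]; [rewrite -md' e eqxx in nd | rewrite mulr0].
have [mp|mp] := boolP (m \in msupp p); last first.
  rewrite memN_msupp_eq0 // big_seq_cond big1 // => m' /andP[mp' _].
  rewrite mcoeffZ mcoeffX; case: eqP => [e|]; last by rewrite mulr0.
  by rewrite -e mp' in mp.
rewrite big_mkcond (bigD1_seq m) //= md eqxx big1 ?addr0.
  by rewrite mcoeffZ mcoeffX eqxx mulr1.
move=> m' nm; case: ifP => // _.
by rewrite mcoeffZ mcoeffX (negbTE nm) mulr0.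
Qed.

Lemma eq_pihomog d (p q : mpoly N R) :
  (forall m, mdeg m = d -> mcoeff m p = mcoeff m q) ->
  pihomog (@mdeg N) d p = pihomog (@mdeg N) d q.
Proof.
by move=> pq; apply/mpolyP => m; rewrite !mcoeff_pihomog; case: eqP => // /pq.
Qed.

Lemma mnm_le_mdeg (m : multinom N) i : (m i <= mdeg m)%N.
Proof. by rewrite mdegE (bigD1 i) //= leq_addr. Qed.

(** Cutting each factor after degree d only affects monomials with an
    exponent above d. *)
Lemma pihomog_gen_prod ys d :
  pihomog (@mdeg N) d (gen_prod ys)
  = pihomog (@mdeg N) d (trunc_prod (esym_seq ys) N d).
Proof.
apply: eq_pihomog => m md.
rewrite /trunc_prod mcoeff_prod_powers; last first.
  by move=> i; rewrite ltnS -md mnm_le_mdeg.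
have -> : gen_prod ys = \prod_(i < N) \sum_(k < (maxn d (size ys)).+1)
    esym_seq ys k *: Xv i ^+ k.
  by apply: eq_bigr => i _; rewrite -prod_factor_expand // ltnS leq_maxr.
rewrite mcoeff_prod_powers // => i.
by rewrite ltnS (leq_trans (mnm_le_mdeg m i)) // md leq_maxl.
Qed.

Lemma pihomogM k d (e p : mpoly N R) :
  e \is @ishomog1 N R k (@mdeg N) ->
  pihomog (@mdeg N) d (e * p)
  = if (k <= d)%N then e * pihomog (@mdeg N) (d - k) p else 0.
Proof.
move=> he.
rewrite {1}(pihomog_partitionE (mf := @mdeg N) (leq_maxl (msize p) d.+1)).
rewrite mulr_sumr raddf_sum /=.
have hp j : e * pihomog (@mdeg N) j p \is @ishomog1 N R (k + j) (@mdeg N).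
  exact: dhomogM he (pihomogP _ _ _).
case: leqP => [kd|dk]; last first.
  rewrite big1 // => j _; apply: pihomog_ne0 (hp j).
  by rewrite neq_ltn (leq_trans dk) ?leq_addr ?orbT.
have jK : (d - k < maxn (msize p) d.+1)%N.
  by rewrite (leq_ltn_trans (leq_subr _ _)) // leq_maxr.
rewrite (bigD1 (Ordinal jK)) //= big1 ?addr0.
  by rewrite pihomog_dE //; have := hp (d - k)%N; rewrite subnKC.
move=> j nj; apply: pihomog_ne0 (hp j).
by apply: contraNneq nj => e1; apply/eqP/val_inj; rewrite /= -[LHS](addKn k) e1.
Qed.

Lemma prod_linear_mesym y :
  \prod_(i < N) (1 + y *: Xv i) = \sum_(k < N.+1) y ^+ k *: mesym N R k.
Proof.
under eq_bigr do rewrite addrC.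
rewrite bigA_distr /=.
have cardN (J : {set 'I_N}) : (#|J| < N.+1)%N.
  by rewrite ltnS -[leqRHS]card_ord max_card.
rewrite (partition_big (fun J : {set 'I_N} => Ordinal (cardN J)) xpredT) //=.
apply: eq_bigr => k _; rewrite scaler_sumr.
apply: eq_big => [J | J /eqP <-] /=; first by rewrite -val_eqE.
rewrite -big_mkcond /= scaler_prod prodr_const //.
Qed.

Lemma gen_prod_cons y ys :
  gen_prod (y :: ys) = \sum_(k < N.+1) y ^+ k *: (mesym N R k * gen_prod ys).
Proof.
rewrite /gen_prod; under eq_bigr do rewrite big_cons.
rewrite big_split prod_linear_mesym /= mulr_suml.
by apply: eq_bigr => k _; rewrite scalerAl.
Qed.

End GenFun.

(** * Partitions and their parts *)

Lemma intpart_eq (la mu : intpart) : perm_eq la mu -> la = mu.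
Proof.
case: la mu => [s s_part] [t t_part] /= st; apply: val_inj => /=.
have [/andP[ss _] /andP[tt _]] := (s_part, t_part).
by apply: (sorted_eq _ _ ss tt st) => [x y z xy yz|x y];
  [exact: leq_trans yz xy | rewrite /geq andbC -eqn_leq eq_sym => /eqP].
Qed.

Lemma intpart_gt0 (la : intpart) k : k \in parts la -> (0 < k)%N.
Proof.
by case: la => s /= /andP[_ s0] ks; rewrite lt0n; apply: contraNneq s0 => <-.
Qed.

Lemma mem_leq_sumn (s : seq nat) k : k \in s -> (k <= sumn s)%N.
Proof. by move=> ks; rewrite (perm_sumn (perm_to_rem ks)) /= leq_addr. Qed.

Lemma intpart_le_weight (la : intpart) k : k \in parts la -> (k <= weight la)%N.
Proof. exact: mem_leq_sumn. Qed.

Lemma count_le_weight (la : intpart) k : (count_mem k la <= weight la)%N.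
Proof.
have h : all (fun x => 0 < x)%N la by apply/allP => x /intpart_gt0.
rewrite /weight -sumn_count; move: (parts la) h.
elim=> //= x s IH /andP[x0 /IH]; by apply: leq_add; case: eqP.
Qed.

Definition partitions d : set intpart := [set la : intpart | weight la = d].

Lemma intpart_count_inj (la mu : intpart) :
  (forall k, 0 < k -> count_mem k la = count_mem k mu)%N -> la = mu.
Proof.
move=> lamu; apply/intpart_eq/allP => /= k; rewrite mem_cat => kin.
by apply/eqP/lamu; case/orP: kin => /intpart_gt0.
Qed.

(** Parts and multiplicities are at most d, so the table of multiplicities
    embeds these partitions into a finite type. *)
Lemma finite_partitions d : finite_set (partitions d).
Proof.
pose f (la : intpart) := [ffun i : 'I_d.+1 => inord (count_mem (i : nat) la) : 'I_d.+1].
have finj : {in partitions d &, injective f}.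
  move=> la mu; rewrite !inE => lad mud /ffunP e.
  apply: intpart_count_inj => k _; have [kd|dk] := ltnP k d.+1.
    have := congr1 val (e (Ordinal kd)); rewrite !ffunE /=.
    have cd (nu : intpart) : weight nu = d -> (count_mem k nu < d.+1)%N.
      by move=> <-; rewrite ltnS count_le_weight.
    by rewrite !inordK // cd.
  have nk (nu : intpart) : weight nu = d -> count_mem k nu = 0%N.
    move=> nud; apply/count_memPn; apply: contraL dk => /intpart_le_weight.
    by rewrite nud -ltnNge ltnS.
  by rewrite !nk.
rewrite -(eq_finite_set (inj_card_eq finj)); exact: finite_finset.
Qed.

Lemma is_intpart_rem k (la : intpart) : is_intpart (rem k la).
Proof.
case: la => s /= /andP[ss s0]; apply/andP; split.
  apply: subseq_sorted (rem_subseq _ _) ss => x y z xy yz; exact: leq_trans yz xy.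
by apply: contra s0; exact: mem_rem.
Qed.

Definition del_part k (la : intpart) := IntPart (is_intpart_rem k la).

Lemma del_part_perm k (la : intpart) :
  k \in parts la -> perm_eq la (k :: del_part k la).
Proof. exact: perm_to_rem. Qed.

Lemma weight_del_part k (la : intpart) :
  k \in parts la -> weight la = (k + weight (del_part k la))%N.
Proof. by move=> kla; rewrite /weight (perm_sumn (del_part_perm kla)). Qed.

(** Removing one part k is inverted by inserting k; this is the reindexing
    that drives the induction in the Cauchy identity. *)
Lemma del_part_bij d k : (0 < k <= d)%N ->
  set_bij (partitions d `&` [set la : intpart | k \in parts la])
    (partitions (d - k)) (del_part k).
Proof.
move=> /andP[k0 kd]; split.
- move=> la [/= <- kla]; by rewrite (weight_del_part kla) addKn.
- move=> la mu; rewrite !inE => -[_ kla] [_ kmu] e.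
  apply: intpart_eq; rewrite (permPl (del_part_perm kla)) e perm_sym.
  exact: del_part_perm.
- move=> mu /= mud; pose s := sort geq (k :: mu).
  have sp : is_intpart s.
    apply/andP; split; first by apply: sort_sorted => x y; exact: leq_total.
    rewrite mem_sort inE negb_or eq_sym -lt0n k0 /=.
    by apply/negP => /intpart_gt0.
  have ks : k \in s by rewrite mem_sort mem_head.
  have sE : perm_eq s (k :: mu) by rewrite perm_sort.
  exists (IntPart sp).
    split; last exact: ks.
    rewrite /partitions /= [LHS](perm_sumn sE : sumn s = _).
    by rewrite /= -/(weight mu) mud subnKC.
  apply: intpart_eq => /=; rewrite -(perm_cons k).
  by rewrite -(permPl (perm_to_rem ks)).
Qed.

Lemma mult_factE n (la : intpart) : (weight la <= n)%N ->
  mult_fact la = (\prod_(1 <= i < n.+1) (count_mem i la)`!)%N.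
Proof.
move=> lan; rewrite /mult_fact [RHS](big_cat_nat _ (n := (weight la).+1)) //=.
rewrite [X in _ = (_ * X)%N]big_nat [X in _ = (_ * X)%N]big1 ?muln1 // => i /andP[lai _].
suff /count_memPn -> : i \notin parts la by [].
by apply: contraL lai => /intpart_le_weight; rewrite -ltnNge ltnS.
Qed.

Lemma mult_fact_gt0 (la : intpart) : (0 < mult_fact la)%N.
Proof. by rewrite /mult_fact prodn_gt0 // => i; rewrite fact_gt0. Qed.

(** Only the multiplicity of k drops, from m to m - 1, and m! = m (m - 1)!. *)
Lemma mult_fact_del k (la : intpart) : k \in parts la ->
  mult_fact la = (count_mem k la * mult_fact (del_part k la))%N.
Proof.
move=> kla; rewrite (mult_factE (leqnn (weight la))).
rewrite (mult_factE (n := weight la)) ?[leqRHS](weight_del_part kla) ?leq_addl //.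
have kr : k \in index_iota 1 (weight la).+1.
  by rewrite mem_index_iota (intpart_gt0 kla) ltnS intpart_le_weight.
rewrite !(bigD1_seq _ kr) ?iota_uniq //= mulnA; congr (_ * _)%N.
  rewrite count_rem kla /= eqxx subn1.
  case E: (count_mem k la) => [|c]; last by rewrite factS.
  by move/count_memPn: E; rewrite kla.
apply: eq_bigr => i ik; rewrite count_rem kla /=.
by rewrite eq_sym (negbTE ik) subn0.
Qed.

Lemma big_iota_count (T : Type) (idx : T) (op : Monoid.com_law idx)
    (f : nat -> T) (s : seq nat) d :
  (forall k, k \in s -> 0 < k <= d)%N ->
  \big[op/idx]_(k <- s) f k
  = \big[op/idx]_(1 <= k < d.+1) iter (count_mem k s) (op (f k)) idx.
Proof.
elim: s => [|x s IH] sd; first by rewrite big_nil big1.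
rewrite big_cons IH => [|k ks]; last by rewrite sd // inE ks orbT.
have xr : x \in index_iota 1 d.+1 by rewrite mem_index_iota ltnS sd ?mem_head.
rewrite !(bigD1_seq _ xr) ?iota_uniq //= eqxx add1n iterS Monoid.mulmA.
by congr (op _ _); apply: eq_bigr => i ix; rewrite eq_sym (negbTE ix).
Qed.

Lemma sum_iota_count (V : nmodType) (f : nat -> V) (s : seq nat) d :
  (forall k, k \in s -> 0 < k <= d)%N ->
  \sum_(k <- s) f k = \sum_(1 <= k < d.+1) f k *+ count_mem k s.
Proof.
by move=> sd; rewrite [LHS](@big_iota_count _ _ _ f s d sd); apply: eq_bigr => k _; rewrite iter_addr_0.
Qed.

Lemma prod_iota_count (A : comNzRingType) (f : nat -> A) (s : seq nat) d :
  (forall k, k \in s -> 0 < k <= d)%N ->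
  \prod_(k <- s) f k = \prod_(1 <= k < d.+1) f k ^+ count_mem k s.
Proof.
by move=> sd; rewrite [LHS](@big_iota_count _ _ _ f s d sd); apply: eq_bigr => k _; rewrite iter_mulr_1.
Qed.

(** * The dual Cauchy identity *)

Section Cauchy.
Variable R : numFieldType.
Implicit Types (ys : seq R) (y : R).

(** The monomial symmetric function m_la(ys): the injective choices that
    differ by permuting equal parts give the same monomial. *)
Definition monomial_sum ys (la : intpart) : R :=
  inj_sum ys la / (mult_fact la)%:R.

Lemma monomial_sum_nil la : monomial_sum [::] la = (weight la == 0)%N%:R.
Proof.
case: la => [[|k s] p]; first by rewrite /monomial_sum /mult_fact /= big_geq // divr1.
have k0 : (0 < k)%N by apply: (@intpart_gt0 (IntPart p)); exact: mem_head.
by rewrite /monomial_sum /= mul0r /weight /= addn_eq0 eqn0Ngt k0.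
Qed.

(** The sum defining [inj_sum] runs over the parts of la with repetition.  Equal
    parts contribute equal terms, and their number cancels against
    [mult_fact], so each distinct part is counted once. *)
Lemma monomial_sum_cons y ys d la : weight la = d ->
  monomial_sum (y :: ys) la = monomial_sum ys la +
    \sum_(1 <= k < d.+1)
      (if k \in parts la then y ^+ k * monomial_sum ys (del_part k la) else 0).
Proof.
move=> lad; rewrite /monomial_sum /= mulrDl; congr (_ + _).
rewrite (@sum_iota_count _ _ _ d); last first.
  by move=> k kla; rewrite (intpart_gt0 kla) -lad intpart_le_weight.
rewrite mulr_suml; apply: eq_bigr => k _; case: ifPn => [kla|/count_memPn ->]; last first.
  by rewrite mulr0n mul0r.
rewrite (mult_fact_del kla) natrM invfM -[X in X * _ = _]mulr_natr -!mulrA; congr (_ * (_ * _)).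
rewrite mulrA divff ?mul1r // pnatr_eq0; apply/eqP => /count_memPn.
by rewrite kla.
Qed.

Lemma elem_sym_del N k la : k \in parts la ->
  elem_sym R N la = mesym N R k * elem_sym R N (del_part k la).
Proof.
by move=> kla; rewrite /elem_sym (perm_big _ (del_part_perm kla)) big_cons.
Qed.

(** Adding a letter y multiplies the product by sum_k y^k e_k; on the other side,
    m_la gains a term for each distinct part k of la, namely y^k times
    m_mu, where mu is la without one part k, and e_la = e_k e_mu.  The two gains
    agree term by term by [del_part_bij]. *)
Lemma cauchy_identity N d ys :
  pihomog (@mdeg N) d (gen_prod N ys)
  = \sum_(la \in partitions d) monomial_sum ys la *: elem_sym R N la.
Proof.
elim: ys d => [|y ys IH] d.
  have -> : gen_prod N ([::] : seq R) = 1.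
    by rewrite /gen_prod big1 // => i _; rewrite big_nil.
  case: d => [|d]; last first.
    rewrite (pihomog_ne0 _ (dhomog1 _ _)) // fsbig1 // => la /= lad.
    by rewrite monomial_sum_nil lad scale0r.
  rewrite pihomog_dE ?dhomog1 //.
  have p0 : is_intpart [::] by [].
  have -> : partitions 0 = [set IntPart p0].
    apply/seteqP; split=> [la la0|_ -> //] /=; apply: intpart_count_inj => k k0.
    rewrite (count_memPn _) //=; apply/negP => /intpart_le_weight.
    by rewrite [weight la]la0 leqNgt k0.
  by rewrite fsbig_set1 monomial_sum_nil scale1r /elem_sym big_nil.
pose F k : mpoly N R := if (k <= d)%N then
  y ^+ k *: (mesym N R k * pihomog (@mdeg N) (d - k) (gen_prod N ys)) else 0.
have -> : pihomog (@mdeg N) d (gen_prod N (y :: ys)) = \sum_(0 <= k < d.+1) F k.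
  rewrite gen_prod_cons raddf_sum /=.
  transitivity (\sum_(0 <= k < N.+1) F k).
    rewrite big_mkord; apply: eq_bigr => k _.
    rewrite linearZ /= (pihomogM _ _ (dhomog_mesym _ _ _)) /F.
    by case: ifP => // _; rewrite scaler0.
  have [Nd|dN] := leqP N d.
    rewrite [RHS](big_cat_nat _ (n := N.+1)) //= [X in _ = _ + X]big_nat.
    rewrite [X in _ = _ + X]big1 ?addr0 // => k /andP[Nk _].
    by rewrite /F mesym_geqnE // mul0r scaler0 if_same.
  rewrite [LHS](big_cat_nat _ (n := d.+1)) //=; last exact: ltnW.
  rewrite [X in _ + X = _]big_nat [X in _ + X = _]big1 ?addr0 // => k /andP[dk _].
  by rewrite /F leqNgt dk.
rewrite big_ltn // {1}/F /= subn0 expr0 scale1r mesym0E mul1r IH.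
have finP := finite_partitions.
(* The term k = 0 above is the induction hypothesis; the others come from la
   with a part k. *)
transitivity (\sum_(la \in partitions d) (monomial_sum ys la *: elem_sym R N la
  + \sum_(1 <= k < d.+1) if k \in parts la then
      (y ^+ k * monomial_sum ys (del_part k la)) *: elem_sym R N la else 0)); last first.
  apply: eq_fsbigr => la; rewrite inE => lad.
  rewrite (monomial_sum_cons _ _ lad) scalerDl scaler_suml; congr (_ + _).
  by apply: eq_bigr => k _; case: ifP => // _; rewrite scale0r.
rewrite fsbig_split //=; congr (_ + _).
rewrite fsbig_finite //= exchange_big /= big_nat [RHS]big_nat.
apply: eq_bigr => k kd; rewrite -fsbig_finite //.
rewrite /F; have [k0 kd'] := andP kd; rewrite -ltnS kd' IH.
have kd1 : (0 < k <= d)%N by rewrite k0 -ltnS.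
rewrite (reindex_fsbig _ _ _ _ (del_part_bij kd1)).
rewrite fsbig_mkcondr !fsbig_finite //= mulr_sumr scaler_sumr.
apply: eq_bigr => la _.
have -> : (la \in [set mu : intpart | k \in parts mu]) = (k \in parts la).
  by apply/idP/idP; rewrite inE.
case: ifP => kla; last by rewrite mulr0 scaler0.
by rewrite (elem_sym_del _ kla) -scalerAr scalerA.
Qed.

Theorem genus_expansion_esym ys :
  genus_expansion (esym_seq ys) (monomial_sum ys).
Proof. by move=> N d; rewrite -pihomog_gen_prod cauchy_identity. Qed.

End Cauchy.

(** * Uniqueness and continuity of the coefficients of a genus *)

Section Independence.
Variable R : realType.

Definition count_mnm n (la : intpart) : multinom n :=
  Multinom [tuple count_mem i.+1 la | i < n].

Lemma elem_sym_comp_mpoly n (la : intpart) : (weight la <= n)%N ->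
  elem_sym R n la
  = comp_mpoly [tuple mesym n R i.+1 | i < n] (mpolyX R (count_mnm n la)).
Proof.
move=> lan; rewrite comp_mpolyX /elem_sym (@prod_iota_count _ _ _ n); last first.
  move=> k kla; rewrite (intpart_gt0 kla); exact: leq_trans (intpart_le_weight kla) lan.
rewrite big_add1 /= big_mkord; apply: eq_bigr => i _.
by rewrite mnmE tnth_mktuple.
Qed.

Lemma count_mnm_inj n : {in [pred la | (weight la <= n)%N] &, injective (count_mnm n)}.
Proof.
move=> la mu; rewrite !inE => lan mun /mnmP e.
apply: intpart_count_inj => -[//|k] _; have [kn|nk] := ltnP k n.
  by have := e (Ordinal kn); rewrite !mnmE.
have c0 (nu : intpart) : (weight nu <= n)%N -> count_mem k.+1 nu = 0%N.
  move=> nun; apply/count_memPn; apply: contraL nk => /intpart_le_weight knu.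
  by rewrite -ltnNge; exact: leq_trans knu nun.
by rewrite !c0.
Qed.

(** The fundamental theorem of symmetric polynomials: the e_la are the images
    of distinct monomials under the injective substitution of e_1, ..., e_n for
    the variables. *)
Lemma elem_sym_free n p (la : 'I_p -> intpart) (c : 'I_p -> R) :
  injective la -> (forall i, weight (la i) <= n)%N ->
  \sum_i c i *: elem_sym R n (la i) = 0 -> forall i, c i = 0.
Proof.
move=> la_inj lan c0 i.
have t0 : \sum_i c i *: mpolyX R (count_mnm n (la i)) = 0.
  apply: msym_fundamental_un0; rewrite -[RHS]c0 raddf_sum /=.
  by apply: eq_bigr => j _; rewrite comp_mpolyZ elem_sym_comp_mpoly.
have := congr1 (mcoeff (count_mnm n (la i))) t0.
rewrite mcoeff0 raddf_sum /= (bigD1 i) //= mcoeffZ mcoeffX eqxx mulr1.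
rewrite big1 ?addr0 // => j ji.
rewrite mcoeffZ mcoeffX; case: eqP => [e|]; last by rewrite mulr0.
by case/eqP: ji; apply/la_inj/(count_mnm_inj _ _ e); rewrite inE.
Qed.

(** A matrix with linearly independent rows has a right inverse.  The columns
    here are the finitely many monomials that occur in some e i. *)
Lemma dual_functionals n p (e : 'I_p -> mpoly n R) :
  (forall c : 'I_p -> R, \sum_i c i *: e i = 0 -> forall i, c i = 0) ->
  exists (ms : seq (multinom n)) (L : 'I_p -> multinom n -> R),
    forall (c : 'I_p -> R) i,
      c i = \sum_(m <- ms) L i m * mcoeff m (\sum_j c j *: e j).
Proof.
move=> efree; pose ms := undup (flatten [seq msupp (e i) | i <- enum 'I_p]).
pose A : 'M[R]_(p, size ms) := \matrix_(i, j) mcoeff (tnth (in_tuple ms) j) (e i).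
have Acoef (v : 'rV_p) j :
    (v *m A) 0 j = mcoeff (tnth (in_tuple ms) j) (\sum_i v 0 i *: e i).
  by rewrite mxE raddf_sum /=; apply: eq_bigr => i _; rewrite mxE mcoeffZ.
have /row_freeP[B AB] : row_free A.
  apply: inj_row_free => v vA0; apply/rowP => i; rewrite mxE.
  apply: efree i; apply/mpolyP => m; rewrite mcoeff0.
  have [/(nthP m)[k kms <-]|mms] := boolP (m \in ms).
    have := Acoef v (Ordinal kms).
    by rewrite vA0 mxE (tnth_nth m) => <-.
  rewrite raddf_sum big1 // => i _; rewrite /= mcoeffZ memN_msupp_eq0 ?mulr0 //.
  apply: contra mms => mi; rewrite mem_undup; apply/flattenP.
  by exists (msupp (e i)) => //; apply: map_f; rewrite mem_enum.
exists ms, (fun i m => if insub (index m ms) is Some j then B j i else 0) => c i.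
have -> : c i = (((\row_j c j) *m A) *m B) 0 i by rewrite -mulmxA AB mulmx1 mxE.
rewrite mxE [RHS]big_tnth.
apply: eq_bigr => j _; rewrite Acoef mulrC; congr (_ * _).
  rewrite (tnth_nth mnm0) index_uniq ?undup_uniq //.
  by rewrite (insubT (fun x => x < size ms)%N (ltn_ord j)); congr (B _ _); apply: val_inj.
by congr (mcoeff _ _); apply: eq_bigr => k _; rewrite mxE.
Qed.

Lemma partitions_enum d :
  exists2 s : seq intpart, uniq s & partitions d = [set` s].
Proof.
have /finite_seqP[s ps] := finite_partitions d.
exists (undup s); first exact: undup_uniq.
by rewrite ps; apply/seteqP; split=> x /=; rewrite mem_undup.
Qed.

(** The weights L are independent of b: the coefficients of an expansion in the e_la are
    linear, hence continuous, functions of the coefficients of the sum. *)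
Lemma partition_functionals d : exists (ms : seq (multinom d)) (L : intpart -> multinom d -> R),
  forall (b : intpart -> R) la, weight la = d ->
    b la = \sum_(m <- ms) L la m *
             mcoeff m (\sum_(mu \in partitions d) b mu *: elem_sym R d mu).
Proof.
have [s us ps] := partitions_enum d.
pose la i := tnth (in_tuple s) i.
have inj_la : injective la by exact/tuple_uniqP.
have le_la i : (weight (la i) <= d)%N.
  by rewrite (_ : weight _ = d) //; have : partitions d (la i) by rewrite ps /= mem_tnth.
have [ms [L Lc]] := dual_functionals (fun c => @elem_sym_free d _ la c inj_la le_la).
exists ms, (fun mu m => if insub (index mu s) is Some j then L j m else 0).
move=> b mu mud; have mus : mu \in s by have : partitions d mu by []; rewrite ps.
rewrite insubT ?index_mem // => ms_lt.
have -> : b mu = b (la (Sub (index mu s) ms_lt)).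
  by rewrite /la (tnth_nth mu) /= nth_index.
rewrite (Lc (fun j => b (la j))); apply: eq_bigr => m _; congr (_ * mcoeff _ _).
by rewrite ps -fsbig_seq // [RHS]big_tnth.
Qed.

Lemma genus_expansion_unique (a : nat -> R) b1 b2 :
  genus_expansion a b1 -> genus_expansion a b2 -> b1 = b2.
Proof.
move=> e1 e2; apply/funext => la.
have [ms [L Lb]] := partition_functionals (weight la).
by rewrite (Lb b1) // (Lb b2) // -/(partitions _) -e1 -e2.
Qed.

Lemma cvg_bigsum (I : Type) (r : seq I) (F : I -> nat -> R) (l : I -> R) :
  (forall i, F i n @[n --> \oo] --> l i) ->
  \sum_(i <- r) F i n @[n --> \oo] --> \sum_(i <- r) l i.
Proof. by move=> h; apply: cvg_big => //; exact: add_continuous. Qed.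

Lemma cvg_bigprod (I : Type) (r : seq I) (F : I -> nat -> R) (l : I -> R) :
  (forall i, F i n @[n --> \oo] --> l i) ->
  \prod_(i <- r) F i n @[n --> \oo] --> \prod_(i <- r) l i.
Proof. by move=> h; apply: cvg_big => //; exact: mul_continuous. Qed.

Lemma mcoeff_trunc_prod (a : nat -> R) N d m :
  mcoeff m (pihomog (@mdeg N) d (trunc_prod a N d))
  = if mdeg m == d then \prod_(i < N) a (m i) else 0.
Proof.
rewrite mcoeff_pihomog; case: eqP => // md; rewrite mcoeff_prod_powers // => i.
by rewrite ltnS -md mnm_le_mdeg.
Qed.

(** By [partition_functionals], bM M la is a fixed linear combination of
    products of the aM M k, so it converges; and the defining identity
    passes to the limit coefficient by coefficient.  This gives at once the
    existence of an expansion for the limit series a and its value. *)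
Theorem genus_coeff_limit (aM : nat -> nat -> R) (bM : nat -> intpart -> R) (a : nat -> R) :
  (forall M, genus_expansion (aM M) (bM M)) ->
  (forall k, aM M k @[M --> \oo] --> a k) ->
  forall la, bM M la @[M --> \oo] --> genus_coeff a la.
Proof.
move=> expM aMa.
have coef_cvg N d m : mcoeff m (pihomog (@mdeg N) d (trunc_prod (aM M) N d)) @[M --> \oo]
    --> mcoeff m (pihomog (@mdeg N) d (trunc_prod a N d)).
  rewrite mcoeff_trunc_prod; under eq_cvg do rewrite mcoeff_trunc_prod.
  by case: ifP => _; [apply: cvg_bigprod => i | exact: cvg_cst].
pose b la := limn (fun M => bM M la).
have bMb la : bM M la @[M --> \oo] --> b la.
  have [ms [L Lb]] := partition_functionals (weight la).
  apply: cvgP; under eq_cvg do rewrite (Lb (bM _)) // -expM.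
  apply: cvg_bigsum => m; apply: cvgM; first exact: cvg_cst.
  exact: coef_cvg.
suff expb : genus_expansion a b.
  rewrite /genus_coeff (_ : xget _ _ = b) //.
  by apply: (xget_unique _ expb) => b' expb'; exact: genus_expansion_unique expb' expb.
move=> N d; apply/mpolyP => m; have [s us ps] := partitions_enum d.
have sumE b' : mcoeff m (\sum_(la \in partitions d) b' la *: elem_sym R N la)
    = \sum_(la <- s) b' la * mcoeff m (elem_sym R N la).
  rewrite ps -fsbig_seq // raddf_sum /=.
  by apply: eq_bigr => la _; rewrite mcoeffZ.
have := coef_cvg N d m; under eq_cvg do rewrite expM sumE.
move=> /cvg_unique; apply=> //; rewrite sumE.
by apply: cvg_bigsum => la; apply: cvgM => //; exact: cvg_cst.
Qed.

End Independence.

(** * Newton's identities *)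

Section Newton.
Variable R : realType.
Implicit Types (ys : seq R) (y B : R).

Definition psum ys k : R := \sum_(y <- ys) y ^+ k.

Lemma esym_seq_nil k : esym_seq ([::] : seq R) k = (k == 0)%N%:R.
Proof. by rewrite /esym_seq big_nil coef1. Qed.

Lemma esym_seq_cons y ys k :
  esym_seq (y :: ys) k.+1 = esym_seq ys k.+1 + y * esym_seq ys k.
Proof.
rewrite /esym_seq big_cons /factor_poly mulrDl mul1r coefD -scalerAl coefZ.
by rewrite coefXM.
Qed.

Lemma esym_seq0 ys : esym_seq ys 0 = 1.
Proof.
elim: ys => [|y ys IH]; first by rewrite esym_seq_nil.
rewrite /esym_seq big_cons /factor_poly mulrDl mul1r coefD -scalerAl coefZ.
by rewrite coefXM mulr0 addr0 -[RHS]IH.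
Qed.

(** Multiplying the generating series of e_k(y :: ys) by y / (1 + y x)
    cancels the factor 1 + y x. *)
Lemma esym_seq_alt y ys n :
  \sum_(i < n.+1) (-1) ^+ i * esym_seq (y :: ys) (n - i) * y ^+ i.+1
  = y * esym_seq ys n.
Proof.
elim: n => [|n IH].
  by rewrite big_ord1 !esym_seq0 expr0 mul1r expr1 mul1r mulr1.
rewrite big_ord_recl /= expr0 mul1r subn0 esym_seq_cons expr1.
under eq_bigr do rewrite /bump /= !add1n subSS.
rewrite (_ : \sum_(i < n.+1) _ = - y * (y * esym_seq ys n)); first by ring.
rewrite -IH mulr_sumr; apply: eq_bigr => i _; rewrite !exprS; ring.
Qed.

(** By induction on the list: in the step from ys to y :: ys the additional
    terms y^(i + 1) of the power sums add up to y e_n(ys) by [esym_seq_alt]. *)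
Theorem newton_identity ys n :
  n.+1%:R * esym_seq ys n.+1
  = \sum_(i < n.+1) (-1) ^+ i * esym_seq ys (n - i) * psum ys i.+1.
Proof.
elim: ys n => [|y ys IH] n.
  rewrite esym_seq_nil mulr0 big1 // => i _; by rewrite /psum big_nil mulr0.
have -> : \sum_(i < n.+1) (-1) ^+ i * esym_seq (y :: ys) (n - i) * psum (y :: ys) i.+1
   = y * esym_seq ys n +
     \sum_(i < n.+1) (-1) ^+ i * esym_seq (y :: ys) (n - i) * psum ys i.+1.
  rewrite -esym_seq_alt -big_split /=; apply: eq_bigr => i _.
  by rewrite /psum big_cons mulrDr.
have -> : \sum_(i < n.+1) (-1) ^+ i * esym_seq (y :: ys) (n - i) * psum ys i.+1
   = n.+1%:R * esym_seq ys n.+1 + y * (n%:R * esym_seq ys n).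
  rewrite IH; case: n => [|n].
    by rewrite !big_ord1 !esym_seq0 mul0r mulr0 addr0.
  rewrite IH [LHS]big_ord_recr [in RHS]big_ord_recr /= subnn !esym_seq0.
  rewrite [RHS]addrAC; congr (_ + _); rewrite mulr_sumr -big_split /=.
  apply: eq_bigr => i _; rewrite subSn -1?ltnS // esym_seq_cons; ring.
rewrite esym_seq_cons -natr1; ring.
Qed.

(** Newton's identity gives n |e_n| <= B (|e_0| + ... + |e_(n - 1)|), and the
    geometric sum of the B (1 + B)^i over i < n is (1 + B)^n - 1. *)
Lemma esym_seq_bound ys B : (forall k, (0 < k)%N -> `|psum ys k| <= B) ->
  forall k, `|esym_seq ys k| <= (1 + B) ^+ k.
Proof.
move=> pB; have B0 : 0 <= B by exact: le_trans (pB 1%N _).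
elim/ltn_ind => -[_|n IH]; first by rewrite esym_seq0 normr1.
have n0 : 0 < n.+1%:R :> R by rewrite ltr0n.
rewrite -(ler_pM2l n0) -[X in X * `|_|](ger0_norm (ltW n0)) -normrM newton_identity.
rewrite (le_trans (ler_norm_sum _ _ _)) //.
apply: (@le_trans _ _ (\sum_(i < n.+1) (1 + B) ^+ i * B)).
  rewrite (reindex_inj rev_ord_inj) /=; apply: ler_sum => i _.
  rewrite !normrM normrX normrN1 expr1n mul1r subSS subKn -1?ltnS //.
  by rewrite ler_pM // ?IH // pB.
have -> : \sum_(i < n.+1) (1 + B) ^+ i * B = (1 + B) ^+ n.+1 - 1.
  rewrite subrX1 -mulr_suml mulrC; congr (_ * _); ring.
rewrite (@le_trans _ _ ((1 + B) ^+ n.+1)) ?lerBlDr ?lerDl //.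
by rewrite ler_peMl ?ler1n // exprn_ge0 // addr_ge0.
Qed.

Lemma esym_seq_cvg (ysM : nat -> seq R) (P : nat -> R) :
  (forall k, (0 < k)%N -> psum (ysM M) k @[M --> \oo] --> P k) ->
  forall k, cvgn (fun M => esym_seq (ysM M) k).
Proof.
move=> pP; elim/ltn_ind => -[_|n IH].
  by under eq_fun do rewrite esym_seq0; exact: is_cvg_cst.
pose a k := limn (fun M => esym_seq (ysM M) k).
have -> : (fun M => esym_seq (ysM M) n.+1) = (fun M => n.+1%:R^-1 *
  \sum_(i < n.+1) (-1) ^+ i * esym_seq (ysM M) (n - i) * psum (ysM M) i.+1).
  by apply/funext => M; rewrite -newton_identity mulKf // pnatr_eq0.
apply/cvg_ex; exists (n.+1%:R^-1 * \sum_(i < n.+1) (-1) ^+ i * a (n - i)%N * P i.+1).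
apply: cvgM; first exact: cvg_cst.
apply: cvg_bigsum => i; apply: cvgM; last exact: pP.
by apply: cvgM; [exact: cvg_cst | apply: IH; rewrite ltnS leq_subr].
Qed.

End Newton.

(** * Tannery's theorem *)

Section Tannery.
Variable R : realType.

(** Domination by g makes the tails of all the series uniformly small, so the
    limit may be taken on finitely many terms. *)
Lemma tannery (F : nat -> nat -> R) (f g S : nat -> R) :
  (forall k, F M k @[M --> \oo] --> f k) ->
  (forall M k, `|F M k| <= g k) ->
  cvgn (series g) ->
  (forall M, series (F M) @ \oo --> S M) ->
  cvgn (series f) /\ S M @[M --> \oo] --> limn (series f).
Proof.
move=> Ff Fg cg FS.
have fg k : `|f k| <= g k.
  by apply: (cvgr_to_le (cvg_norm (Ff k))); apply: nearW => M; exact: Fg.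
have g0 k : 0 <= g k by exact: le_trans (Fg 0%N k).
have cf : cvgn (series f).
  by apply: normed_cvg; exact: (series_le_cvg _ g0 fg cg).
split=> //.
have tail (h : nat -> R) (s : R) n : (forall k, `|h k| <= g k) -> series h @ \oo --> s ->
    `|s - series h n| <= limn (series g) - series g n.
  move=> hg hs.
  have c1 : `|series h m - series h n| @[m --> \oo] --> `|s - series h n|.
    by apply: cvg_norm; apply: cvgB => //; exact: cvg_cst.
  have c2 : series g m - series g n @[m --> \oo] --> limn (series g) - series g n.
    by apply: cvgB => //; exact: cvg_cst.
  apply: (ler_cvg_to c1 c2); near=> m.
  have nm : (n <= m)%N by near: m; exact: nbhs_infty_ge.
  rewrite !sub_series_geq // (le_trans (ler_norm_sum _ _ _)) //.
  exact: ler_sum.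
apply/cvgrPdist_lt => e e0; have e3 : 0 < e / 3 by rewrite divr_gt0.
have [n _ gn] : \forall n \near \oo, `|limn (series g) - series g n| < e / 3.
  by move/cvgrPdist_lt : cg; apply.
have cn : series (F M) n @[M --> \oo] --> series f n.
  by rewrite /series /=; apply: cvg_bigsum.
(* The limit differs from S M by two tails and a finite sum. *)
near=> M.
have h1 : `|limn (series f) - series f n| < e / 3.
  apply: le_lt_trans (gn n _); last by rewrite /=.
  by apply: le_trans (tail _ _ _ fg cf) _; exact: ler_norm.
have h2 : `|S M - series (F M) n| < e / 3.
  apply: le_lt_trans (gn n _); last by rewrite /=.
  by apply: le_trans (tail _ _ _ (Fg M) (FS M)) _; exact: ler_norm.
have h3 : `|series f n - series (F M) n| < e / 3.
  by near: M; move/cvgrPdist_lt : cn; apply.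
have -> : limn (series f) - S M = (limn (series f) - series f n)
   + (series f n - series (F M) n) - (S M - series (F M) n) by ring.
rewrite (le_lt_trans (ler_normB _ _)) // (le_lt_trans (lerD (ler_normD _ _) (lexx _))) //.
lra.
Unshelve. all: by end_near. Qed.

End Tannery.

(** * Taylor coefficients of power series *)

Section Taylor.
Variable R : realType.
Implicit Types (a : nat -> R) (f : R -> R).

(** A growth condition that [pseries_diffs] preserves, unlike a fixed radius of
    convergence; so it can be carried through repeated differentiation. *)
Definition exp_bounded a := exists C E : R,
  [/\ 0 <= C, 0 < E & forall k, `|a k| <= C * E ^+ k].

Lemma is_cvg_pseries_exp_bounded a (C E x : R) :
  0 <= C -> 0 < E -> (forall k, `|a k| <= C * E ^+ k) -> E * `|x| < 1 ->
  cvgn (pseries a x).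
Proof.
move=> C0 E0 aE Ex; apply: normed_cvg.
apply: (@series_le_cvg _ _ (geometric C (E * `|x|))).
- by move=> n /=.
- by move=> n /=; rewrite mulr_ge0 // exprn_ge0 // mulr_ge0 // ltW.
- move=> n /=; rewrite normrM normrX exprMn mulrA ler_wpM2r ?exprn_ge0 //.
by apply: is_cvg_geometric_series; rewrite ger0_norm // mulr_ge0 // ltW.
Qed.

(** Because k + 1 <= 2^k. *)
Lemma pseries_diffs_bound a (C E : R) : 0 <= C -> 0 < E ->
  (forall k, `|a k| <= C * E ^+ k) ->
  forall k, `|pseries_diffs a k| <= C * E * (2 * E) ^+ k.
Proof.
move=> C0 E0 aE k; rewrite /pseries_diffs normrM ger0_norm ?ler0n //.
rewrite (le_trans (ler_wpM2l (ler0n _ _) (aE _))) // exprS exprMn.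
rewrite [leLHS](_ : _ = k.+1%:R * (C * E * E ^+ k)); last by ring.
rewrite [leRHS](_ : _ = 2 ^+ k * (C * E * E ^+ k)); last by ring.
rewrite ler_wpM2r //; first by rewrite !mulr_ge0 ?exprn_ge0 // ltW.
by rewrite -natrX ler_nat ltn_expl.
Qed.

Lemma derive1_pseries_near f a : exp_bounded a ->
  (\forall x \near 0, f x = limn (pseries a x)) ->
  \forall x \near 0, derive1 f x = limn (pseries (pseries_diffs a) x).
Proof.
move=> [C [E [C0 E0 aE]]] fa.
have E2 : 0 < 2 * E by rewrite mulr_gt0.
have CE : 0 <= C * E by rewrite mulr_ge0 // ltW.
have dE := pseries_diffs_bound C0 E0 aE.
have ddE := pseries_diffs_bound CE E2 dE.
(* The second derived series is bounded by powers of 4 E, so K < 1 / (4 E). *)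
pose K := (5 * E)^-1; have K0 : 0 < K by rewrite invr_gt0 mulr_gt0.
have EK : E * K = 5^-1 by rewrite /K invfM mulrCA divff ?mulr1 // gt_eqF.
have nK : `|K| = K by rewrite gtr0_norm.
have cK : cvgn (pseries a K).
  by apply: is_cvg_pseries_exp_bounded C0 E0 aE _; rewrite nK EK; lra.
have cdK : cvgn (pseries (pseries_diffs a) K).
  by apply: is_cvg_pseries_exp_bounded CE E2 dE _; rewrite nK -mulrA EK; lra.
have cddK : cvgn (pseries (pseries_diffs (pseries_diffs a)) K).
  apply: is_cvg_pseries_exp_bounded _ _ ddE _; [|by rewrite mulr_gt0|].
    by rewrite mulr_ge0 // ltW.
  by rewrite nK -!mulrA EK; lra.
have fax : \forall x \near 0, \forall y \near x, f y = limn (pseries a y).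
  exact: near_join.
near=> x.
have xK : `|x| < `|K|.
  by rewrite nK -[x]subr0 distrC; near: x; apply: nbhsx_ballx.
have [d1 d2] := pseries_snd_diffs cK cdK cddK xK.
rewrite -d2 derive1E; apply: near_eq_derive.
by near: x.
Unshelve. all: by end_near. Qed.

Lemma pseries0 a : limn (pseries a 0) = a 0%N.
Proof.
apply/cvg_lim => //; rewrite -cvg_shiftS.
rewrite (_ : [sequence _]_n = fun=> a 0%N); first exact: cvg_cst.
apply/funext => n /=; rewrite /pseries /series /= big_nat_recl //= expr0 mulr1.
by rewrite big1 ?addr0 // => i _; rewrite exprS mul0r mulr0.
Qed.

Theorem taylor_coeff_pseries f a : exp_bounded a ->
  (\forall x \near 0, f x = limn (pseries a x)) ->
  forall k, taylor_coeff f k = a k.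
Proof.
move=> ab fa k; rewrite /taylor_coeff.
suff -> : derive1n k f 0 = k`!%:R * a k by rewrite mulrC mulKf // pnatr_eq0 -lt0n fact_gt0.
elim: k f a ab fa => [|k IH] f a ab fa.
  by rewrite derive1n0 (nbhs_singleton fa) pseries0 fact0 mul1r.
rewrite derive1Sn (IH _ (pseries_diffs a)); last exact: derive1_pseries_near.
  by rewrite /pseries_diffs factS natrM; ring.
case: ab => C [E [C0 E0 aE]]; exists (C * E), (2 * E); split.
- by rewrite mulr_ge0 // ltW.
- by rewrite mulr_gt0.
- exact: pseries_diffs_bound.
Qed.

End Taylor.

(** * Finite alphabets approximating the Weierstrass product *)

Section WeierstrassAlphabet.
Variables (R : realType) (g : R).

(** The letters 1/n, ..., 1/2, 1, the most recent one first as in [inj_sum]. *)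
Fixpoint recips (n : nat) : seq R :=
  if n is n'.+1 then n'.+1%:R^-1 :: recips n' else [::].

Lemma perm_recips n : perm_eq (recips n) [seq i%:R^-1 | i <- index_iota 1 n.+1].
Proof.
rewrite /index_iota subn1 /=; elim: n => [//|n IH].
by rewrite -addn1 iotaD map_cat perm_sym perm_catC /= add1n addn1 perm_cons perm_sym.
Qed.

Lemma big_recips (T : Type) (idx : T) (op : Monoid.com_law idx) (F : R -> T) n :
  \big[op/idx]_(y <- recips n) F y = \big[op/idx]_(1 <= i < n.+1) F i%:R^-1.
Proof. by rewrite (perm_big _ (perm_recips n)) big_map. Qed.

Lemma recips_le1 n y : y \in recips n -> `|y| <= 1.
Proof.
elim: n => [//|n IH]; rewrite inE => /orP[/eqP ->|/IH //].
by rewrite ger0_norm ?invr_ge0 // invf_le1 ?ler1n // ltr0n.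
Qed.

Lemma psum1_recips_le n : 0 <= psum (recips n) 1 <= n%:R.
Proof.
rewrite /psum; elim: n => [|n IH]; first by rewrite big_nil lexx.
have h : 0 <= (n.+1%:R : R)^-1 <= 1.
  by rewrite invr_ge0 ler0n invf_le1 ?ler1n // ltr0n.
by rewrite /= big_cons expr1; move: h; set v := _^-1 => h; rewrite -natr1; lra.
Qed.

(** Telescoping: 1/(n + 1)^2 <= 1/n - 1/(n + 1). *)
Lemma psum2_recips_le n : psum (recips n.+1) 2 <= 2 - n.+1%:R^-1.
Proof.
rewrite /psum; elim: n => [|n IH].
  by rewrite /= big_cons big_nil invr1 expr1n; lra.
rewrite [recips _]/= big_cons.
have n0 : 0 < n.+1%:R :> R by rewrite ltr0n.
have n1 : n.+2%:R = n.+1%:R + 1 :> R by rewrite natr1.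
rewrite -/(recips n.+1) n1; move: n0 IH; set u : R := n.+1%:R.
set s := \sum_(_ <- _) _ => u0 IH.
suff : (u + 1)^-1 ^+ 2 <= u^-1 - (u + 1)^-1.
  by move: IH; move: ((u + 1)^-1) (u^-1) => p q; lra.
have -> : u^-1 - (u + 1)^-1 = u^-1 * (u + 1)^-1 by field; lra.
rewrite expr2 ler_wpM2r //; first by rewrite invr_ge0; lra.
by rewrite lef_pV2 ?posrE; lra.
Qed.

Lemma psum2_recips_le2 n : psum (recips n) 2 <= 2.
Proof.
case: n => [|n]; first by rewrite /psum big_nil.
by rewrite (le_trans (psum2_recips_le n)) // lerBlDr lerDl invr_ge0.
Qed.

Lemma psum_le_psum2 (ys : seq R) k : (forall y, y \in ys -> `|y| <= 1) -> (1 < k)%N ->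
  `|psum ys k| <= psum ys 2.
Proof.
move=> ys1 k2; rewrite (le_trans (ler_norm_sum _ _ _)) // big_seq [leRHS]big_seq.
apply: ler_sum => y yys; rewrite normrX -[leRHS]ger0_norm ?sqr_ge0 // normrX.
by rewrite ler_wiXn2l // ys1.
Qed.

Lemma psum_recips_cvg k : (1 < k)%N -> cvgn (fun n => psum (recips n) k).
Proof.
move=> k2; apply: nondecreasing_is_cvgn.
  apply/nondecreasing_seqP => n; rewrite /psum /= big_cons lerDr exprn_ge0 //.
exists 2 => _ [n _ <-].
rewrite (le_trans (ler_norm _)) // (le_trans (psum_le_psum2 (@recips_le1 n) k2)) //.
exact: psum2_recips_le2.
Qed.

(** The exponent c for which exp(c x) times the product of the 1 + x/i, i <= n, is the
    n-th partial product of the Weierstrass formula. *)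
Definition drift n : R := g - psum (recips n) 1.

(** The number L of letters c / L that replace exp(c x).  As |c| <= (|g| + 1) (n + 1),
    this size gives L (c / L)^2 <= 1/(n + 1)^2 ([copies_spread2]): an error that
    tends to 0 and that, being at most 1 from the start, keeps every letter
    in [-1, 1]. *)
Definition copies n : nat := (Num.bound ((`|g| + 1) ^+ 2) * n.+1 ^ 4)%N.

Definition spread n : R := drift n / (copies n)%:R.

Definition approx_alphabet n : seq R := nseq (copies n) (spread n) ++ recips n.

Lemma copies_gt0 n : 0 < (copies n)%:R :> R.
Proof.
rewrite ltr0n muln_gt0 expn_gt0 andbT -(ltr0n R).
by apply: le_lt_trans (archi_boundP _); rewrite ?sqr_ge0.
Qed.

Lemma copies_spread2 n : (copies n)%:R * spread n ^+ 2 <= (n.+1%:R ^+ 2)^-1.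
Proof.
have c0 := copies_gt0 n.
have -> : (copies n)%:R * spread n ^+ 2 = drift n ^+ 2 / (copies n)%:R.
  by rewrite /spread; field; rewrite gt_eqF.
have n0 : 0 < n.+1%:R :> R by rewrite ltr0n.
rewrite ler_pdivrMr // /copies natrM natrX.
have -> : (n.+1%:R ^+ 2)^-1 * ((Num.bound ((`|g| + 1) ^+ 2))%:R * n.+1%:R ^+ 4)
   = (Num.bound ((`|g| + 1) ^+ 2))%:R * n.+1%:R ^+ 2 :> R.
  by field; rewrite gt_eqF.
apply: (@le_trans _ _ ((`|g| + 1) ^+ 2 * n.+1%:R ^+ 2)); last first.
  by rewrite ler_wpM2r ?sqr_ge0 // ltW // archi_boundP // sqr_ge0.
rewrite -exprMn -real_normK ?num_real // lerXn2r ?nnegrE //.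
rewrite /drift (le_trans (ler_normB _ _)) //.
have /andP[p0 pn] := psum1_recips_le n.
rewrite (ger0_norm p0) -natr1; have := normr_ge0 g; have := ler0n R n.
by move: (`|g|) (psum _ _) pn => G s sn n0' G0; nra.
Qed.

Lemma copies_spread2_le1 n : (copies n)%:R * spread n ^+ 2 <= 1.
Proof.
rewrite (le_trans (copies_spread2 n)) // invf_le1 ?exprn_gt0 ?ltr0n //.
by rewrite exprn_ege1 // ler1n.
Qed.

Lemma spread_le1 n : `|spread n| <= 1.
Proof.
rewrite -(@ler_pXn2r _ 2) ?nnegrE // expr1n real_normK ?num_real //.
apply: le_trans (_ : (copies n)%:R * spread n ^+ 2 <= 1).
  by rewrite ler_peMl ?sqr_ge0 // ler1n -(ltr0n R) copies_gt0.
exact: copies_spread2_le1.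
Qed.

Lemma approx_alphabet_le1 n y : y \in approx_alphabet n -> `|y| <= 1.
Proof.
rewrite mem_cat => /orP[|/recips_le1 //]; rewrite mem_nseq => /andP[_ /eqP ->].
exact: spread_le1.
Qed.

Lemma psum_approx_alphabet n k :
  psum (approx_alphabet n) k = (copies n)%:R * spread n ^+ k + psum (recips n) k.
Proof.
by rewrite /psum big_cat big_nseq iter_addr_0 mulr_natl.
Qed.

Lemma psum_approx_alphabet1 n : psum (approx_alphabet n) 1 = g.
Proof.
rewrite psum_approx_alphabet expr1 /spread mulrCA divff ?mulr1.
  by rewrite /drift subrK.
by rewrite gt_eqF // copies_gt0.
Qed.

Lemma psum2_approx_alphabet_le n : psum (approx_alphabet n) 2 <= 3.
Proof.
rewrite psum_approx_alphabet; have := copies_spread2_le1 n.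
by have := psum2_recips_le2 n; lra.
Qed.

Lemma psum_approx_alphabet_bound n k : (0 < k)%N ->
  `|psum (approx_alphabet n) k| <= `|g| + 3.
Proof.
case: k => [//|[|k]] _; first by rewrite psum_approx_alphabet1 lerDl.
rewrite (le_trans (psum_le_psum2 (@approx_alphabet_le1 n) _)) //.
by rewrite (le_trans (psum2_approx_alphabet_le n)) // lerDr.
Qed.

Lemma cvg_copies_spread2 : (copies n)%:R * spread n ^+ 2 @[n --> \oo] --> 0.
Proof.
have h : (n.+1%:R ^+ 2 : R)^-1 @[n --> \oo] --> 0.
  under eq_cvg do rewrite -exprVn expr2.
  have : (harmonic n * harmonic n : R) @[n --> \oo] --> (0 * 0 : R).
    by apply: cvgM; exact: cvg_harmonic.
  by rewrite mulr0.
apply: (squeeze_cvgr _ (cvg_cst 0) h); apply: nearW => n.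
by rewrite copies_spread2 mulr_ge0 ?sqr_ge0.
Qed.

Lemma cvg_copies_spread k : (1 < k)%N ->
  (copies n)%:R * spread n ^+ k @[n --> \oo] --> 0.
Proof.
move=> k2; apply/norm_cvg0P; apply: (squeeze_cvgr _ (cvg_cst 0) cvg_copies_spread2).
apply: nearW => n; rewrite normr_ge0 /= normrM ger0_norm ?ler0n //.
rewrite ler_wpM2l // normrX -[leRHS]ger0_norm ?sqr_ge0 // normrX.
by rewrite ler_wiXn2l // spread_le1.
Qed.

Lemma psum_approx_alphabet_cvg k : (0 < k)%N ->
  cvgn (fun n => psum (approx_alphabet n) k).
Proof.
case: k => [//|[|k]] _.
  by under eq_fun do rewrite psum_approx_alphabet1; exact: is_cvg_cst.
under eq_fun do rewrite psum_approx_alphabet.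
apply: is_cvgD; last exact: psum_recips_cvg.
by apply: cvgP; apply: cvg_copies_spread.
Qed.

Definition limit_coeff k : R := limn (fun n => esym_seq (approx_alphabet n) k).

Lemma esym_approx_alphabet_cvg k :
  esym_seq (approx_alphabet n) k @[n --> \oo] --> limit_coeff k.
Proof.
exact: (@esym_seq_cvg _ _ (fun k => limn (fun n => psum (approx_alphabet n) k))
          (fun k k0 => psum_approx_alphabet_cvg k0) k).
Qed.

Lemma esym_approx_alphabet_bound n k : `|esym_seq (approx_alphabet n) k| <= (`|g| + 4) ^+ k.
Proof.
rewrite (_ : `|g| + 4 = 1 + (`|g| + 3)); last by ring.
by apply: esym_seq_bound => j; exact: psum_approx_alphabet_bound.
Qed.

Lemma limit_coeff_bound k : `|limit_coeff k| <= 1 * (`|g| + 4) ^+ k.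
Proof.
rewrite mul1r; apply: (cvgr_to_le (cvg_norm (@esym_approx_alphabet_cvg k))).
by apply: nearW => n; exact: esym_approx_alphabet_bound.
Qed.

Lemma prod_esym_series (ys : seq R) x :
  series (fun k => esym_seq ys k * x ^+ k) @ \oo --> \prod_(y <- ys) (1 + y * x).
Proof.
have -> : \prod_(y <- ys) (1 + y * x) = (\prod_(y <- ys) factor_poly y).[x].
  rewrite horner_prod; apply: eq_bigr => y _.
  by rewrite /factor_poly !hornerE.
rewrite /esym_seq; set p := \prod_(y <- ys) factor_poly y.
apply: cvg_near_cst; near=> n.
have pn : (size p <= n)%N by near: n; exact: nbhs_infty_ge.
by rewrite /series /= (horner_coef_wide _ pn) big_mkord.
Unshelve. all: by end_near. Qed.

Lemma cvg_prod_approx_alphabet x : (`|g| + 4) * `|x| < 1 ->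
  \prod_(y <- approx_alphabet n) (1 + y * x) @[n --> \oo] --> limn (pseries limit_coeff x).
Proof.
move=> gx.
have g0 : 0 <= `|g| + 4 by rewrite addr_ge0.
apply: (proj2 (@tannery _ (fun n k => esym_seq (approx_alphabet n) k * x ^+ k)
          (fun k => limit_coeff k * x ^+ k) (geometric 1 ((`|g| + 4) * `|x|)) _ _ _ _ _))
    => [k|n k||n].
- by apply: cvgM; [exact: esym_approx_alphabet_cvg | exact: cvg_cst].
- rewrite /geometric /= mul1r exprMn normrM normrX ler_wpM2r ?exprn_ge0 //.
  exact: esym_approx_alphabet_bound.
- by apply: is_cvg_geometric_series; rewrite ger0_norm // mulr_ge0.
- exact: prod_esym_series.
Qed.

Lemma bernoulli_le (t : R) n : 0 <= t <= 1 -> 1 - n%:R * t <= (1 - t) ^+ n.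
Proof.
move=> /andP[t0 t1]; elim: n => [|n IH]; first by rewrite mul0r subr0 expr0.
have := ler_wpM2r (_ : 0 <= 1 - t) IH; rewrite subr_ge0 -exprSr => /(_ t1).
by apply: le_trans; rewrite -natr1; have := ler0n R n; nra.
Qed.

(** With v = c x / L one has 1 - v^2 <= (1 + v) exp(-v) <= 1; raising to the power
    L and using Bernoulli's inequality, the quantity lies between
    1 - L v^2 and 1. *)
Lemma cvg_expR_correction x :
  ((1 + spread n * x) * expR (- (spread n * x))) ^+ copies n @[n --> \oo] --> (1 : R).
Proof.
have h0 : 1 - x ^+ 2 * ((copies n)%:R * spread n ^+ 2) @[n --> \oo] --> (1 : R).
  suff : 1 - x ^+ 2 * ((copies n)%:R * spread n ^+ 2) @[n --> \oo] --> (1 - x ^+ 2 * 0 : R).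
    by rewrite mulr0 subr0.
  apply: cvgB; first exact: cvg_cst.
  by apply: cvgM; [exact: cvg_cst|exact: cvg_copies_spread2].
have h1 : (1 : R) @[_ --> \oo] --> (1 : R) by exact: cvg_cst.
apply: (squeeze_cvgr _ h0 h1).
near=> n; set v := spread n * x; set L := copies n.
have L1 : 1 <= L%:R :> R by rewrite ler1n -(ltr0n R) copies_gt0.
have vL : L%:R * v ^+ 2 = x ^+ 2 * (L%:R * spread n ^+ 2) by rewrite /v; ring.
have v1 : 0 <= v ^+ 2 <= 1.
  rewrite sqr_ge0 /=; apply: (@le_trans _ _ (L%:R * v ^+ 2)).
    by rewrite ler_peMl ?sqr_ge0.
  rewrite vL /L -subr_ge0 ltW //; near: n.
  exact: (cvgr_gt _ h0 _ ltr01).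
have vb : `|v| <= 1.
  by rewrite -(@ler_pXn2r _ 2) ?nnegrE // expr1n real_normK ?num_real //; case/andP: v1.
have /andP[vl vr] : -1 <= v <= 1 by rewrite -ler_norml.
have u0 : 0 <= 1 + v by lra.
have e0 := expR_gt0 (- v).
apply/andP; split.
  rewrite -vL (le_trans (bernoulli_le _ v1)) // lerXn2r // ?nnegrE.
  - by rewrite subr_ge0; case/andP: v1.
  - by rewrite mulr_ge0 // ltW.
  rewrite (_ : 1 - v ^+ 2 = (1 + v) * (1 - v)); last by ring.
  by rewrite ler_wpM2l // expR_ge1Dx.
rewrite exprn_ile1 //; first by rewrite mulr_ge0 // ltW.
by rewrite expRN ler_pdivrMr ?expR_gt0 // mul1r expR_ge1Dx.
Unshelve. all: by end_near. Qed.

Definition weierstrass (x : R) : R := expR (g * x) *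
  limn (fun n => \prod_(1 <= i < n.+1) ((1 + x / i%:R) * expR (- (x / i%:R)))).

(** The factors exp(-x/i) multiply to exp(-(1 + ... + 1/n) x), and
    L (c / L) = c = g - (1 + ... + 1/n). *)
Lemma weierstrass_partial x n : 1 + spread n * x != 0 ->
  \prod_(1 <= i < n.+1) ((1 + x / i%:R) * expR (- (x / i%:R)))
  = expR (- (g * x)) * (\prod_(y <- approx_alphabet n) (1 + y * x) /
      ((1 + spread n * x) * expR (- (spread n * x))) ^+ copies n).
Proof.
move=> v0; rewrite big_split /=.
have -> : \prod_(1 <= i < n.+1) (1 + x / i%:R) = \prod_(y <- recips n) (1 + y * x).
  by rewrite big_recips; apply: eq_bigr => i _; rewrite mulrC.
have -> : \prod_(1 <= i < n.+1) expR (- (x / i%:R)) = expR (- (psum (recips n) 1 * x)).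
  rewrite /psum big_recips mulr_suml -sumrN expR_sum.
  by apply: eq_bigr => i _; rewrite expr1 mulrC.
rewrite /approx_alphabet big_cat big_nseq iter_mulr_1 exprMn -expRM_natl.
have -> : (copies n)%:R * - (spread n * x) = - (drift n * x).
  rewrite mulrN mulrA /spread mulrCA divff ?mulr1 //.
  by rewrite gt_eqF // copies_gt0.
rewrite invfM -expRN opprK mulrACA divff ?expf_neq0 // mul1r mulrCA; congr (_ * _).
by rewrite -expRD; congr expR; rewrite /drift; ring.
Qed.

Lemma weierstrass_pseries x : (`|g| + 4) * `|x| < 1 ->
  weierstrass x = limn (pseries limit_coeff x).
Proof.
move=> gx; rewrite /weierstrass.
have x1 : `|x| < 1 by have := normr_ge0 g; have := normr_ge0 x; nra.
have v0 n : 1 + spread n * x != 0.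
  suff /ltr_normlP[] : `|spread n * x| < 1 by move=> *; lra.
  by rewrite normrM (le_lt_trans _ x1) // ler_piMl // spread_le1.
under eq_fun do rewrite weierstrass_partial //.
have h : expR (- (g * x)) * (\prod_(y <- approx_alphabet n) (1 + y * x) /
      ((1 + spread n * x) * expR (- (spread n * x))) ^+ copies n) @[n --> \oo]
   --> expR (- (g * x)) * (limn (pseries limit_coeff x) / 1).
  apply: cvgM; first exact: cvg_cst.
  apply: cvgM; first exact: cvg_prod_approx_alphabet.
  by apply: cvgV; [exact: oner_neq0 | exact: cvg_expR_correction].
by rewrite (cvg_lim _ h) // divr1 mulrA expRN mulfV ?mul1r // gt_eqF // expR_gt0.
Qed.

Theorem taylor_coeff_weierstrass k : taylor_coeff weierstrass k = limit_coeff k.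
Proof.
have g0 : 0 < `|g| + 4 by rewrite ltr_wpDl.
apply: taylor_coeff_pseries.
  by exists 1, (`|g| + 4); split => //; exact: limit_coeff_bound.
have r0 : 0 < (`|g| + 4)^-1 by rewrite invr_gt0.
near=> x; apply: weierstrass_pseries.
rewrite -ltr_pdivlMl // mulr1 -[x]subr0 distrC; near: x.
Unshelve. all: by end_near. Qed.

End WeierstrassAlphabet.

(** * Injective sums are insensitive to many small letters *)

Section InjSumLimit.
Variable R : realType.
Implicit Types (ys : seq R) (t : seq nat).

Lemma ler_norm_sum_size (T : eqType) (s : seq T) (F : T -> R) (c : R) :
  (forall x, x \in s -> `|F x| <= c) -> `|\sum_(x <- s) F x| <= (size s)%:R * c.
Proof.
elim: s => [|x s IH] Fc; first by rewrite big_nil normr0 mul0r.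
rewrite big_cons /= -[(size s).+1%:R]nat1r mulrDl mul1r (le_trans (ler_normD _ _)) //.
by rewrite lerD ?Fc ?mem_head // IH // => z zs; rewrite Fc // inE zs orbT.
Qed.

(** As |y| <= 1 and every exponent is at least 2, each |y|^k is at most y^2, and
    dropping injectivity leaves a power of the sum of the y^2.  In the induction
    this is (q + s)^(r + 1) >= q^(r + 1) + (r + 1) s q^r. *)
Lemma inj_sum_bound ys t : (forall y, y \in ys -> `|y| <= 1) ->
  (forall k, k \in t -> (1 < k)%N) -> `|inj_sum ys t| <= psum ys 2 ^+ size t.
Proof.
have p0 zs : 0 <= psum zs 2 :> R by apply: sumr_ge0 => y _; exact: sqr_ge0.
elim: ys t => [|y ys IH] t ys1 t2.
  rewrite /= -size_eq0 /psum big_nil expr0n; case: eqP => _; by rewrite ?normr1 ?normr0.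
have ys1' z : z \in ys -> `|z| <= 1 by move=> zs; apply: ys1; rewrite inE zs orbT.
have y1 : `|y| <= 1 by apply: ys1; rewrite mem_head.
have t2' k j : j \in rem k t -> (1 < j)%N by move/mem_rem; exact: t2.
rewrite [inj_sum _ _]/= (le_trans (ler_normD _ _)) //.
have -> : psum (y :: ys) 2 = y ^+ 2 + psum ys 2 by rewrite /psum big_cons.
case st : (size t) => [|r].
  by rewrite (size0nil st) big_nil normr0 addr0 expr0; have := IH [::] ys1'; rewrite expr0; exact.
apply: (@le_trans _ _ (psum ys 2 ^+ r.+1 + r.+1%:R * (y ^+ 2 * psum ys 2 ^+ r))).
  rewrite lerD //; first by rewrite -st IH.
  rewrite -[in X in X%:R]st; apply: ler_norm_sum_size => k kt.
  rewrite normrM ler_pM // ?normrX.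
    by rewrite -[leRHS]ger0_norm ?sqr_ge0 // normrX ler_wiXn2l // t2.
  have sr : size (rem k t) = r by rewrite size_rem // st.
  by rewrite -[X in _ ^+ X]sr IH // => j; exact: t2'.
have q0 := p0 ys; move: (psum ys 2) q0 (y ^+ 2) (sqr_ge0 y) => q q0 s s0.
elim: r {st} => [|r IHr]; first by rewrite !expr1 expr0; lra.
rewrite [leRHS]exprS; apply: le_trans (ler_wpM2l _ IHr); last exact: addr_ge0.
rewrite [q ^+ r.+2]exprS [q ^+ r.+1]exprS.
have := exprn_ge0 r q0; move: (q ^+ r) => u u0.
rewrite -[r.+2%:R]natr1; have := ler0n R r.+1; move: (r.+1%:R : R) => w w0.
have : 0 <= s * s * u * w by rewrite !mulr_ge0.
by move=> ?; rewrite -subr_ge0 (_ : _ - _ = s * s * u * w) //; ring.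
Qed.

(** Each additional letter v adds one term for each entry k of t, with a factor
    v^k and k at least 2. *)
Lemma inj_sum_nseq_cat n (v Q : R) ys t : `|v| <= 1 ->
  (forall y, y \in ys -> `|y| <= 1) -> (forall k, k \in t -> (1 < k)%N) ->
  psum (nseq n v ++ ys) 2 <= Q -> 1 <= Q ->
  `|inj_sum (nseq n v ++ ys) t - inj_sum ys t|
  <= n%:R * v ^+ 2 * ((size t)%:R * Q ^+ size t).
Proof.
move=> v1 ys1 t2 pQ Q1; elim: n pQ => [|n IH] pQ.
  by rewrite /= subrr normr0 !mul0r.
have pQ' : psum (nseq n v ++ ys) 2 <= Q.
  by apply: le_trans pQ; rewrite /psum /= big_cons lerDr sqr_ge0.
rewrite [inj_sum (nseq n.+1 v ++ ys) t]/=.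
rewrite addrAC (le_trans (ler_normD _ _)) //.
rewrite -[n.+1%:R]natr1 !mulrDl lerD ?IH // mul1r.
rewrite mulrCA; apply: ler_norm_sum_size => k kt.
rewrite normrM ler_pM // ?normrX.
  by rewrite -[leRHS]ger0_norm ?sqr_ge0 // normrX ler_wiXn2l // t2.
apply: le_trans (inj_sum_bound _ _) _.
- move=> y; rewrite mem_cat mem_nseq => /orP[/andP[_ /eqP ->//]|]; exact: ys1.
- by move=> j /mem_rem; exact: t2.
rewrite size_rem // (le_trans (_ : _ <= Q ^+ (size t).-1)) //.
  rewrite lerXn2r ?nnegrE //; last by exact: le_trans ler01 Q1.
  by apply: sumr_ge0 => y _; exact: sqr_ge0.
by rewrite ler_weXn2l // leq_pred.
Qed.

Lemma inj_sum_approx_alphabet_cvg (g : R) t : (forall k, k \in t -> (1 < k)%N) ->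
  inj_sum (approx_alphabet g n) t - inj_sum (recips R n) t @[n --> \oo] --> 0.
Proof.
move=> t2; apply/norm_cvg0P.
have h : (copies g n)%:R * spread g n ^+ 2 * ((size t)%:R * 3 ^+ size t) @[n --> \oo] --> (0 : R).
  suff : (copies g n)%:R * spread g n ^+ 2 * ((size t)%:R * 3 ^+ size t) @[n --> \oo]
     --> (0 * ((size t)%:R * 3 ^+ size t) : R) by rewrite mul0r.
  by apply: cvgM; [exact: cvg_copies_spread2 | exact: cvg_cst].
apply: (squeeze_cvgr _ (cvg_cst 0) h); apply: nearW => n.
rewrite normr_ge0 /approx_alphabet /=.
apply: (@inj_sum_nseq_cat (copies g n) (spread g n) 3 (recips R n) t) => //.
- exact: spread_le1.
- exact: recips_le1.
- exact: psum2_approx_alphabet_le.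
- lra.
Qed.

End InjSumLimit.

(** * Truncated multiple zeta values *)

Section TruncatedZeta.
Variable R : realType.

(** The sum over n >= n_1 > ... > n_r >= 1, with n_1 = j chosen first. *)
Fixpoint trunc_mzeta (t : seq nat) (n : nat) : R :=
  if t is k :: t' then \sum_(1 <= j < n.+1) j%:R^-1 ^+ k * trunc_mzeta t' j.-1
  else 1.

Lemma trunc_mzeta_ge0 t n : 0 <= trunc_mzeta t n.
Proof.
elim: t n => [|k t IH] n //=; apply: sumr_ge0 => j _.
by rewrite mulr_ge0 // exprn_ge0 // invr_ge0.
Qed.

Lemma trunc_mzeta0 k t : trunc_mzeta (k :: t) 0 = 0.
Proof. by rewrite /= big_geq. Qed.

Lemma trunc_mzetaS k t n :
  trunc_mzeta (k :: t) n.+1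
  = trunc_mzeta (k :: t) n + n.+1%:R^-1 ^+ k * trunc_mzeta t n.
Proof. by rewrite /= big_nat_recr. Qed.

(** A permutation s of n + 1 points is given by i = s(0) and the induced
    bijection from the nonzero points to the points other than i. *)
Lemma sum_perm_lift (V : nmodType) n (F : 'S_n.+1 -> V) :
  \sum_(s : 'S_n.+1) F s = \sum_(i < n.+1) \sum_(s : 'S_n) F (lift_perm ord0 i s).
Proof.
rewrite (partition_big (fun s : 'S_n.+1 => s ord0) predT) //=.
apply: eq_bigr => i _; rewrite (reindex (lift_perm ord0 i)).
  by apply: eq_bigl => s; rewrite lift_perm_id eqxx.
have inj_lift : injective (lift_perm ord0 i : 'S_n -> 'S_n.+1).
  move=> s1 s2 e; apply/permP => k; apply: (@lift_inj _ i).
  by rewrite -!(lift_perm_lift ord0) e.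
pose tail (s : 'S_n.+1) k := odflt k (unlift (s ord0) (s (lift ord0 k))).
have tailK (s : 'S_n.+1) k : lift (s ord0) (tail s k) = s (lift ord0 k).
  rewrite /tail; have := neq_lift ord0 k.
  by rewrite -(can_eq (permK s)) => /unlift_some[] ? ? ->.
have tail_inj (s : 'S_n.+1) : injective (tail s).
  by move=> k1 k2 e; apply: (@lift_inj _ ord0); apply: (@perm_inj _ s); rewrite -!tailK e.
exists (fun s => perm (tail_inj s)) => [s _|s].
  by apply/permP => k; rewrite permE /tail lift_perm_lift lift_perm_id liftK.
move/(s _ =P _) => si0; apply/permP => k.
case: (unliftP ord0 k) => [k'|] ->; rewrite ?lift_perm_id //.
by rewrite lift_perm_lift -si0 permE tailK.
Qed.

Lemma map_enum_ordS (T : Type) n (t : 'I_n.+1 -> T) :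
  [seq t i | i <- enum 'I_n.+1] = t ord0 :: [seq t (lift ord0 i) | i <- enum 'I_n].
Proof. by rewrite enum_ordSl /= -map_comp. Qed.

Lemma perm_rem_lift n (t : 'I_n.+1 -> nat) i :
  perm_eq (rem (t i) [seq t j | j <- enum 'I_n.+1]) [seq t (lift i j) | j <- enum 'I_n].
Proof.
rewrite -(perm_cons (t i)).
have ti : t i \in [seq t j | j <- enum 'I_n.+1] by rewrite map_f ?mem_enum.
rewrite -(permPl (perm_to_rem ti)).
have -> : t i :: [seq t (lift i j) | j <- enum 'I_n]
    = [seq t j | j <- i :: [seq lift i j | j <- enum 'I_n]].
  by rewrite /= -map_comp.
apply/perm_map/uniq_perm.
- exact: enum_uniq.
- rewrite /= map_inj_uniq ?enum_uniq ?andbT; last exact: lift_inj.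
  by apply/mapP => -[j _ /eqP]; rewrite (negbTE (neq_lift i j)).
- move=> j; rewrite mem_enum [LHS]inE [RHS]inE; case: (unliftP i j) => [j'|] ->; last by rewrite eqxx.
  by rewrite map_f ?orbT // mem_enum.
Qed.

(** Sorting the values of an injective map leaves a decreasing tuple and a
    permutation.  Formally, both sides satisfy the same recursion in n: when
    the letter 1/(n + 1) is used, it is used for n_1, and s(0) is the entry of t
    to which it is assigned. *)
Theorem sum_perm_trunc_mzeta n r (t : 'I_r -> nat) :
  \sum_(s : 'S_r) trunc_mzeta [seq t (s i) | i <- enum 'I_r] n
  = inj_sum (recips R n) [seq t i | i <- enum 'I_r].
Proof.
elim: n r t => [|n IH] [|r] t.
- rewrite (eq_bigr (fun=> 1)) => [|s _]; last by rewrite (size0nil (size_enum_ord 0)).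
  by rewrite sumr_const card_Sn (size0nil (size_enum_ord 0)).
- rewrite map_enum_ordS /= big1 // => s _; by rewrite map_enum_ordS trunc_mzeta0.
- have := IH 0%N t; rewrite (size0nil (size_enum_ord 0)) /= => ->.
  by rewrite big_nil addr0.
have -> : \sum_(s : 'S_r.+1) trunc_mzeta [seq t (s i) | i <- enum 'I_r.+1] n.+1
    = \sum_(s : 'S_r.+1) trunc_mzeta [seq t (s i) | i <- enum 'I_r.+1] n
    + \sum_(s : 'S_r.+1) n.+1%:R^-1 ^+ t (s ord0)
          * trunc_mzeta [seq t (s (lift ord0 i)) | i <- enum 'I_r] n.
  rewrite -big_split; apply: eq_bigr => s _.
  by rewrite map_enum_ordS trunc_mzetaS -(map_enum_ordS (fun i => t (s i))).
rewrite IH [inj_sum (recips R n.+1) _]/=; congr (_ + _).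
rewrite big_map big_enum sum_perm_lift /=; apply: eq_bigr => i _.
rewrite (inj_sum_perm _ (perm_rem_lift t i)) -IH mulr_sumr; apply: eq_bigr => s _.
by rewrite lift_perm_id; under eq_map do rewrite lift_perm_lift.
Qed.

End TruncatedZeta.

(** * Multiple zeta values as limits of truncated ones *)

Section MultipleZeta.
Variable R : realType.

Definition decreasing_tuples r : set {ffun 'I_r -> nat} :=
  [set n | (forall i j : 'I_r, (i < j)%N -> (n j < n i)%N) /\
           (forall i, (1 <= n i)%N)].

Arguments decreasing_tuples : clear implicits.

Definition mzeta_term r (t : 'I_r -> nat) (n : {ffun 'I_r -> nat}) : R :=
  \prod_(i < r) (n i)%:R^-1 ^+ t i.

Lemma mzeta_term_ge0 r t n : 0 <= @mzeta_term r t n.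
Proof. by apply: prodr_ge0 => i _; rewrite exprn_ge0 // invr_ge0. Qed.

Definition ffun_cons r (p : nat * {ffun 'I_r -> nat}) : {ffun 'I_r.+1 -> nat} :=
  [ffun i => if unlift ord0 i is Some j then p.2 j else p.1].

Lemma ffun_cons0 r p : @ffun_cons r p ord0 = p.1.
Proof. by rewrite ffunE unlift_none. Qed.

Lemma ffun_cons_lift r p i : @ffun_cons r p (lift ord0 i) = p.2 i.
Proof. by rewrite ffunE liftK. Qed.

Definition bounded_tuples r m : set {ffun 'I_r -> nat} :=
  decreasing_tuples r `&` [set n | forall i, (n i <= m)%N].

Arguments bounded_tuples : clear implicits.

Lemma ffun_cons_bij r (I : set nat) :
  set_bij ((I `&` [set j | 1 <= j]%N) `*`` (fun j => bounded_tuples r j.-1))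
    (decreasing_tuples r.+1 `&` [set n | I (n ord0)]) (@ffun_cons r).
Proof.
split.
- move=> [j n] [[/= Ij j1] [[ndec n1] nj]]; split; last by rewrite /= ffun_cons0.
  split=> [i k|i].
    case: (unliftP ord0 i) => [i'|] ->; case: (unliftP ord0 k) => [k'|] ->;
      rewrite ?ffun_cons0 ?ffun_cons_lift //=.
    + by rewrite /bump !add1n ltnS; exact: ndec.
    + by move=> _; rewrite (leq_ltn_trans (nj k')) // prednK.
  by case: (unliftP ord0 i) => [i'|] ->; rewrite ?ffun_cons0 ?ffun_cons_lift.
- move=> [j n] [j' n'] _ _ /ffunP e; congr (_, _).
    by have := e ord0; rewrite !ffun_cons0.
  by apply/ffunP => i; have := e (lift ord0 i); rewrite !ffun_cons_lift.
- move=> n [[ndec n1] In]; exists (n ord0, [ffun i => n (lift ord0 i)]).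
    split=> /=; first by split; [exact: In | exact: n1].
    split; first split=> [i k ik|i]; rewrite ?ffunE.
    + by apply: ndec; rewrite !lift0 ltnS.
    + exact: n1.
    + move=> i; rewrite ffunE -ltnS prednK ?n1 //; exact: ndec.
  apply/ffunP => i; case: (unliftP ord0 i) => [i'|] ->.
    by rewrite ffun_cons_lift ffunE.
  by rewrite ffun_cons0.
Qed.

Lemma mzeta_term_cons r (t : 'I_r.+1 -> nat) p :
  mzeta_term t (ffun_cons p)
  = p.1%:R^-1 ^+ t ord0 * mzeta_term (fun i => t (lift ord0 i)) p.2.
Proof.
rewrite /mzeta_term big_ord_recl ffun_cons0; congr (_ * _).
by apply: eq_bigr => i _; rewrite ffun_cons_lift.
Qed.

Local Open Scope ereal_scope.

(** The constant c absorbs the factors already split off, so that iterating this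
    lemma never requires moving a scalar through an infinite sum. *)
Lemma esum_tuples_cons r (t : 'I_r.+1 -> nat) (I : set nat) (c : R) : (0 <= c)%R ->
  \esum_(n in decreasing_tuples r.+1 `&` [set n | I (n ord0)]) (c * mzeta_term t n)%:E
  = \esum_(j in I `&` [set j | 1 <= j]%N)
      \esum_(n in bounded_tuples r j.-1)
        (c * j%:R^-1 ^+ t ord0 * mzeta_term (fun i => t (lift ord0 i)) n)%:E.
Proof.
move=> c0; rewrite (reindex_esum _ _ _ _ (@ffun_cons_bij r I)).
rewrite esum_esum; last first.
  by move=> j n _ _; rewrite lee_fin !mulr_ge0 ?mzeta_term_ge0 ?exprn_ge0 ?invr_ge0.
by apply: eq_esum => -[j n] _; rewrite mzeta_term_cons mulrA.
Qed.

Lemma esum_bounded_tuples r (t : 'I_r -> nat) m (c : R) : (0 <= c)%R ->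
  \esum_(n in bounded_tuples r m) (c * mzeta_term t n)%:E
  = (c * trunc_mzeta R [seq t i | i <- enum 'I_r] m)%:E.
Proof.
elim: r t m c => [|r IH] t m c c0.
  pose n0 : {ffun 'I_0 -> nat} := [ffun=> 0%N].
  have -> : bounded_tuples 0 m = [set n0].
    apply/seteqP; split=> [n _ /=|n _]; first by apply/ffunP => -[].
    by split; [split|] => -[].
  rewrite (size0nil (size_enum_ord 0)) esum_set1 /mzeta_term big_ord0 //.
  by rewrite mulr1 lee_fin.
have -> : bounded_tuples r.+1 m
    = decreasing_tuples r.+1 `&` [set n | (n ord0 <= m)%N].
  apply/seteqP; split=> n [[ndec n1] /= nm]; split.
  - by split.
  - exact: nm.
  - by split.
  move=> i /=; apply: leq_trans nm; case: (unliftP ord0 i) => [i'|] -> //.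
  by apply: ltnW; exact: ndec.
rewrite (@esum_tuples_cons _ _ [set j | (j <= m)%N]) //.
under eq_esum do rewrite IH ?mulr_ge0 ?exprn_ge0 ?invr_ge0 //.
rewrite map_enum_ordS /=.
have -> : [set j | (j <= m)%N] `&` [set j | (1 <= j)%N] = [set` index_iota 1 m.+1].
  apply/seteqP; split=> j /=; rewrite mem_index_iota ltnS; last by move=> /andP[].
  by move=> [-> ->].
rewrite esum_fset; [|exact: finite_seq|]; last first.
  move=> j _; rewrite lee_fin !mulr_ge0 ?exprn_ge0 ?invr_ge0 //.
  exact: trunc_mzeta_ge0.
rewrite -fsbig_seq ?iota_uniq // sumEFin mulr_sumr.
by congr EFin; apply: eq_bigr => j _; rewrite mulrA.
Qed.

(** Summing over n_1 last leaves a series of nonnegative terms over n_1, whose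
    partial sums are the truncated values. *)
Lemma mzeta_limit r (t : 'I_r -> nat) :
  cvgn (trunc_mzeta R [seq t i | i <- enum 'I_r]) ->
  trunc_mzeta R [seq t i | i <- enum 'I_r] @ \oo --> mzeta (fun i => (t i)%:R : R).
Proof.
have termE (n : {ffun 'I_r -> nat}) : ((\prod_(i < r) ((n i)%:R `^ (t i)%:R))^-1)%R = (1 * mzeta_term t n)%R.
  rewrite mul1r /mzeta_term -prodfV; apply: eq_bigr => i _.
  by rewrite powR_mulrn // exprVn.
rewrite /mzeta; under eq_esum do rewrite termE.
rewrite -/(decreasing_tuples r).
case: r t {termE} => [|r] t tc.
  have := @esum_bounded_tuples 0 t 0 1 ler01.
  rewrite (_ : bounded_tuples 0 0 = decreasing_tuples 0); last first.
    by apply/seteqP; split=> [n []|n nd] //; split=> // -[].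
  move=> ->; rewrite (size0nil (size_enum_ord 0)) mul1r /=; exact: cvg_cst.
(* No bound on n_1, but the later entries are bounded by n_1 - 1. *)
have -> : decreasing_tuples r.+1 = decreasing_tuples r.+1 `&` [set n | setT (n ord0)].
  by apply/seteqP; split=> [n nd|n []] //; split.
rewrite esum_tuples_cons // setTI.
under eq_esum do rewrite esum_bounded_tuples ?mulr_ge0 ?exprn_ge0 ?invr_ge0 //.
rewrite -(@nneseries_esum _ _ (fun j => 1 <= j)%N); last first.
  move=> j _; rewrite lee_fin !mulr_ge0 ?exprn_ge0 ?invr_ge0 //.
  exact: trunc_mzeta_ge0.
rewrite (_ : \big[_/_]_(_ <= _ <oo | _) _
    = (limn (trunc_mzeta R [seq t i | i <- enum 'I_r.+1]))%:E); first exact: tc.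
apply/cvg_lim => //; rewrite -cvg_shiftS.
rewrite (_ : [sequence _]_n = EFin \o trunc_mzeta R [seq t i | i <- enum 'I_r.+1]).
  by apply: cvg_EFin; [exact: nearW | exact: tc].
apply/funext => n /=; rewrite map_enum_ordS /= big_mkcond big_ltn //= add0e.
rewrite -sumEFin; apply: eq_big_nat => j /andP[j1 _].
by rewrite j1 mul1r.
Qed.

End MultipleZeta.

Section MzetaLimit.
Variable R : realType.

Lemma trunc_mzeta_nondecreasing t : nondecreasing_seq (@trunc_mzeta R t).
Proof.
apply/nondecreasing_seqP => n; case: t => [|k t] //.
by rewrite trunc_mzetaS lerDl mulr_ge0 ?trunc_mzeta_ge0 // exprn_ge0 // invr_ge0.
Qed.

(** The truncated value is one of the nonnegative terms of
    [sum_perm_trunc_mzeta], hence at most [inj_sum], which is bounded by a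
    power of 1 + 1/4 + 1/9 + ... <= 2. *)
Lemma trunc_mzeta_cvg r (t : 'I_r -> nat) : (forall i, 1 < t i)%N ->
  cvgn (trunc_mzeta R [seq t i | i <- enum 'I_r]).
Proof.
move=> t2; apply: nondecreasing_is_cvgn; first exact: trunc_mzeta_nondecreasing.
exists (2 ^+ r) => _ [n _ <-].
apply: (@le_trans _ _ (inj_sum (recips R n) [seq t i | i <- enum 'I_r])).
  rewrite -sum_perm_trunc_mzeta (bigD1 (1%g : 'S_r)) //=.
  rewrite [X in trunc_mzeta _ X n + _](_ : _ = [seq t i | i <- enum 'I_r]); last first.
    by apply: eq_map => i; rewrite perm1.
  by rewrite lerDl sumr_ge0 // => s _; exact: trunc_mzeta_ge0.
rewrite (le_trans (ler_norm _)) // (le_trans (inj_sum_bound (@recips_le1 R n) _)) //.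
  by move=> k /mapP[i _ ->].
rewrite size_map size_enum_ord lerXn2r ?nnegrE ?psum2_recips_le2 //.
by apply: sumr_ge0 => y _; exact: sqr_ge0.
Qed.

Lemma mzetaS_part_limit (la : intpart) : (forall k, k \in parts la -> (1 < k)%N) ->
  inj_sum (recips R n) la @[n --> \oo] --> mzetaS_part R la.
Proof.
move=> la2; pose t (i : 'I_(size la)) := nth 0%N la i.
have tla : [seq t i | i <- enum 'I_(size la)] = la.
  rewrite (map_comp (nth 0%N la) val) val_enum_ord; exact: mkseq_nth.
have t2 i : (1 < t i)%N by apply/la2/mem_nth.
under eq_cvg do rewrite -[X in inj_sum _ X]tla -sum_perm_trunc_mzeta.
rewrite /mzetaS_part /mzetaS; apply: cvg_bigsum => s.
exact: (mzeta_limit (trunc_mzeta_cvg (t := fun i => t (s i)) (fun i => t2 (s i)))).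
Qed.

Lemma inj_sum_recips_ge0 n t : 0 <= inj_sum (recips R n) t.
Proof.
elim: n t => [|n IH] t /=; first by case: eqP.
rewrite addr_ge0 // sumr_ge0 // => k _; by rewrite mulr_ge0 // exprn_ge0 // invr_ge0.
Qed.

Lemma inj_sum_recips_gt0 n t : (size t <= n)%N -> 0 < inj_sum (recips R n) t.
Proof.
elim: n t => [|n IH] t tn /=; first by rewrite -size_eq0 -leqn0 tn.
have rest0 s : 0 <= \sum_(k <- s) n.+1%:R^-1 ^+ k * inj_sum (recips R n) (rem k t).
  by apply: sumr_ge0 => k _; rewrite mulr_ge0 ?inj_sum_recips_ge0 // exprn_ge0 ?invr_ge0.
case: t tn rest0 => [|k t] tn rest0; first by rewrite ltr_pwDl ?IH.
rewrite ltr_wpDl ?inj_sum_recips_ge0 // big_cons.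
apply: ltr_pwDl; last exact: (rest0 t).
by rewrite /= eqxx mulr_gt0 ?IH // exprn_gt0 ?invr_gt0 // ltr0n.
Qed.

Lemma mzetaS_part_gt0 (la : intpart) : (forall k, k \in parts la -> (1 < k)%N) ->
  0 < mzetaS_part R la.
Proof.
move=> la2; have lim := mzetaS_part_limit la2.
apply: lt_le_trans (inj_sum_recips_gt0 (leqnn (size la))) _.
apply: (cvgr_to_ge lim); exists (size la) => // n /= len.
suff : nondecreasing_seq (fun n => inj_sum (recips R n) la) by apply.
apply/nondecreasing_seqP => m /=; rewrite lerDl sumr_ge0 // => k _.
by rewrite mulr_ge0 ?inj_sum_recips_ge0 // exprn_ge0 // invr_ge0.
Qed.

End MzetaLimit.

(** * The Gamma-genus *)

Section GammaGenus.
Variable R : realType.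

Lemma Gamma_seriesE : Gamma_series R = limit_coeff (euler_gamma R).
Proof. by apply/funext => k; exact: taylor_coeff_weierstrass. Qed.

Lemma parts_gt1 (la : intpart) : multiplicity 1 la = 0%N ->
  forall k, k \in parts la -> (1 < k)%N.
Proof.
move=> /count_memPn la1 k kla; have := intpart_gt0 kla.
by case: k kla => [|[|k]] // kla; rewrite kla in la1.
Qed.

Theorem genus_coeff_Gamma (la : intpart) : multiplicity 1 la = 0%N ->
  genus_coeff (Gamma_series R) la = mzetaS_part R la / (mult_fact la)%:R.
Proof.
move=> /parts_gt1 la2; pose g := euler_gamma R.
have lim1 : monomial_sum (approx_alphabet g n) la @[n --> \oo]
    --> genus_coeff (Gamma_series R) la.
  apply: (genus_coeff_limit (fun n => genus_expansion_esym (approx_alphabet g n))) => k.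
  by rewrite Gamma_seriesE; exact: esym_approx_alphabet_cvg.
apply: cvg_unique lim1 _ => //.
apply: cvgM; last exact: cvg_cst.
rewrite (_ : (fun n => inj_sum (approx_alphabet g n) la) = (fun n =>
  (inj_sum (approx_alphabet g n) la - inj_sum (recips R n) la) + inj_sum (recips R n) la)).
  rewrite -[mzetaS_part R la]add0r.
  by apply: cvgD; [exact: inj_sum_approx_alphabet_cvg | exact: mzetaS_part_limit].
by apply/funext => n; rewrite subrK.
Qed.

End GammaGenus.

Lemma chern_number_eq0 n (M : chern_data n) (la : intpart) :
  calabi_yau M -> 1%N \in parts la -> chern_number M la = 0.
Proof.
move=> [k k0 c1k] la1; rewrite /chern_number (perm_big _ (del_part_perm la1)) big_cons.
set rest := \prod_(_ <- _) _.
have /eqP : fund_eval M (chern_class M 1 * rest) *+ k = 0.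
  by rewrite -raddfMn /= -mulrnAl c1k mul0r raddf0.
by rewrite mulrn_eq0 gtn_eqF //= => /eqP.
Qed.

Theorem theorem1p3 (R : realType) :
  (forall la : intpart, multiplicity 1 la = 0%N ->
     genus_coeff (Gamma_series R) la = mzetaS_part R la / (mult_fact la)%:R
     /\ 0 < genus_coeff (Gamma_series R) la)
  /\
  (forall (n : nat) (M : chern_data n), calabi_yau M ->
     genus (Gamma_series R) M
     = \sum_(la \in [set la : intpart | weight la = n /\ multiplicity 1 la = 0%N])
         mzetaS_part R la / (mult_fact la)%:R * (chern_number M la)%:~R).
Proof.
split=> [la la1|n M cyM].
  rewrite genus_coeff_Gamma //; split=> //.
  by rewrite divr_gt0 ?ltr0n ?mult_fact_gt0 // mzetaS_part_gt0 //; exact: parts_gt1.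
rewrite /genus -(fsbig_widen [set la : intpart | weight la = n /\ multiplicity 1 la = 0%N]).
- by apply: eq_fsbigr => la; rewrite inE => -[_ la1]; rewrite genus_coeff_Gamma.
- by move=> la [].
move=> la [/= lan nla]; rewrite chern_number_eq0 ?mulr0 //.
by apply: contra_notT nla => /count_memPn la1; split.
Qed.
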